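(* For every $\epsilon\in(0,1/2]$ there exists a constant $C>0$ depending only on $\epsilon$ such that the following holds. Let $\gamma\in(0,1)$ and let $Y=(Y^1,\dots,Y^T)$ be observations of a dynamic network with missing links having a change-point at $\tau\in\{1,\dots,T-1\}$ with jump $\Delta\Theta\neq0$. Put $\Delta=\|\Pi\odot\Delta\Theta\|_{2\to2}$, $x^*=\tau/T$ and $\widehat x=\widehat\tau_n/T$, where $$\widehat\tau_n\in\arg\max_{1\le t\le T-1}\|Z_T(t)\|_{2\to2}.$$ Then, with probability larger than $1-\gamma$, $$|\widehat x-x^*|\ \le\ \frac{6\sqrt2(1+\epsilon)}{\Delta\,q(x^* )}\Bigl(\frac{\omega_n}{T}\Bigr)^{1/2}+\frac{C}{\Delta\,q(x^* )}\,\frac{\log(2nT/\gamma)}{\sqrt T}.$$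
   Context: Notation: $\|M\|_{2\to2}$ is the operator (spectral) norm of a matrix, $\|M\|_{1,\infty}=\max_j\sum_i|M_{ij}|$, $\odot$ is the entrywise (Hadamard) product, $q(t)=\sqrt{t(1-t)}$ for $t\in[0,1]$. Model: $Y^1,\dots,Y^T$ ($T\ge2$) are independent over $t$; each $Y^t$ is a symmetric $\{0,1\}$-valued $n\times n$ matrix with zero diagonal and $Y^t_{ij}=\Omega^t_{ij}A^t_{ij}$, where for $i<j$ the variables $A^t_{ij}\sim\mathrm{Bernoulli}(\Theta^t_{ij})$ and $\Omega^t_{ij}\sim\mathrm{Bernoulli}(\Pi_{ij})$ are all mutually independent. Here $\Pi\in[0,1]^{n\times n}$ is symmetric with $\Pi_{ii}=1$ and $\Pi_{ij}>0$, and $\Theta^t\in[0,1]^{n\times n}$ are symmetric with zero diagonal. There is a change at $\tau$: $\Theta^t=\Theta^0$ for $1\le t\le\tau$ and $\Theta^t=\Theta^0+\Delta\Theta$ for $\tau<t\le T$. The sparsity parameter $\omega_n$ satisfies $\max_{1\le t\le T}\|\Pi\odot\Theta^t\|_{1,\infty}\le\omega_n$. Matrix CUSUM statistic: for $t=1,\dots,T-1$, $$Z_T(t)=\sqrt{\frac{t(T-t)}T}\Bigl(\frac1t\sum_{s=1}^tY^s-\frac1{T-t}\sum_{s=t+1}^TY^s\Bigr).$$ *)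

(* Defs.v *)
From HB Require Import structures.
From mathcomp Require Import all_boot all_order all_algebra.
From mathcomp Require Import all_classical all_reals all_analysis.

Set Implicit Arguments.
Unset Strict Implicit.
Unset Printing Implicit Defensive.

Import Order.TTheory GRing.Theory Num.Theory.

Local Open Scope classical_set_scope.
Local Open Scope ring_scope.

Definition l2norm (R : realType) (n : nat) (x : 'cV[R]_n) : R :=
  Num.sqrt (\sum_(i < n) x i 0 ^+ 2).

Definition opnorm22 (R : realType) (m n : nat) (M : 'M[R]_(m, n)) : R :=
  sup [set l2norm (M *m x) | x in [set x : 'cV[R]_n | l2norm x <= 1]].

Definition norm1inf (R : realType) (m n : nat) (M : 'M[R]_(m, n)) : R :=
  \big[Num.max/0]_(j < n) \sum_(i < m) `|M i j|.

Definition hadamard (R : realType) (m n : nat) (A B : 'M[R]_(m, n)) :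
  'M[R]_(m, n) := map2_mx (fun a b => a * b) A B.

Definition qfun (R : realType) (t : R) : R := Num.sqrt (t * (1 - t)).

(* Mutual independence of the subfamily (X i), i in D; the finite subfamilies
   are listed by duplicate-free sequences J. *)
Definition mutually_independent (R : realType) (d d' : measure_display)
    (W : measurableType d) (S : measurableType d') (P : probability W R)
    (I : eqType) (D : set I) (X : I -> {RV P >-> S}) : Prop :=
  forall (J : seq I) (B : I -> set S),
    uniq J -> (forall i, i \in J -> D i) ->
    (forall i, i \in J -> measurable (B i)) ->
    P (\bigcap_(i in [set i | i \in J]) (X i @^-1` B i)) =
    (\prod_(i <- J) P (X i @^-1` B i))%E.

(* Times range over 1, ..., T: time-indexed families are functions on nat, only
   constrained (and only used) there. *)
Record network_parameters (R : realType) (n T : nat) (Pi : 'M[R]_n)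
    (Theta : nat -> 'M[R]_n) : Prop := NetworkParameters {
  Pi_sym : forall i j, Pi i j = Pi j i ;
  Pi_diag : forall i, Pi i i = 1 ;
  Pi_gt0 : forall i j, 0 < Pi i j ;
  Pi_le1 : forall i j, Pi i j <= 1 ;
  Theta_sym : forall t, (1 <= t <= T)%N ->
    forall i j, Theta t i j = Theta t j i ;
  Theta_diag : forall t, (1 <= t <= T)%N -> forall i, Theta t i i = 0 ;
  Theta_itv : forall t, (1 <= t <= T)%N -> forall i j, 0 <= Theta t i j <= 1
}.

(* The link variables A t i j and the observation masks Om t i j are indexed
   jointly by nat * 'I_n * 'I_n + nat * 'I_n * 'I_n; only the indices with
   1 <= t <= T and i < j matter, Y t being completed by symmetry. *)
Definition joint_family (n : nat) (X : Type) (A Om : nat -> 'I_n -> 'I_n -> X)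
    (k : nat * 'I_n * 'I_n + nat * 'I_n * 'I_n) : X :=
  match k with
  | inl (t, i, j) => A t i j
  | inr (t, i, j) => Om t i j
  end.

Definition joint_index (n T : nat) :
    set (nat * 'I_n * 'I_n + nat * 'I_n * 'I_n) :=
  [set k : nat * 'I_n * 'I_n + nat * 'I_n * 'I_n |
    match k with
    | inl (t, i, j) | inr (t, i, j) => (1 <= t <= T)%N /\ (i < j)%N
    end].

Record missing_links_data (R : realType) (d : measure_display)
    (W : measurableType d) (P : probability W R) (n T : nat) (Pi : 'M[R]_n)
    (Theta : nat -> 'M[R]_n) (A Om : nat -> 'I_n -> 'I_n -> {RV P >-> bool})
    (Y : nat -> W -> 'M[R]_n) : Prop := MissingLinksData {
  link_law : forall t (i j : 'I_n), (1 <= t <= T)%N -> (i < j)%N ->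
    distribution P (A t i j) =1 bernoulli_prob (Theta t i j) ;
  mask_law : forall t (i j : 'I_n), (1 <= t <= T)%N -> (i < j)%N ->
    distribution P (Om t i j) =1 bernoulli_prob (Pi i j) ;
  link_mask_indep :
    mutually_independent (@joint_index n T) (joint_family A Om) ;
  obs_sym : forall t w, (1 <= t <= T)%N -> forall i j, Y t w i j = Y t w j i ;
  obs_diag : forall t w, (1 <= t <= T)%N -> forall i, Y t w i i = 0 ;
  obs_eq : forall t w (i j : 'I_n), (1 <= t <= T)%N -> (i < j)%N ->
    Y t w i j = (Om t i j w)%:R * (A t i j w)%:R
}.

Definition missing_links_network (R : realType) (d : measure_display)
    (W : measurableType d) (P : probability W R) (n T : nat) (Pi : 'M[R]_n)
    (Theta : nat -> 'M[R]_n) (Y : nat -> W -> 'M[R]_n) : Prop :=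
  network_parameters T Pi Theta /\
  exists A Om : nat -> 'I_n -> 'I_n -> {RV P >-> bool},
    missing_links_data T Pi Theta A Om Y.

Definition change_point (R : realType) (n T : nat) (Theta : nat -> 'M[R]_n)
    (tau : nat) (dTheta : 'M[R]_n) : Prop :=
  exists Theta0 : 'M[R]_n,
    (forall t, (1 <= t <= tau)%N -> Theta t = Theta0) /\
    (forall t, (tau < t <= T)%N -> Theta t = Theta0 + dTheta).

Definition cusum (R : realType) (n T : nat) (Y : nat -> 'M[R]_n) (t : nat) :
    'M[R]_n :=
  Num.sqrt (t%:R * (T%:R - t%:R) / T%:R) *:
    (t%:R^-1 *: (\sum_(1 <= s < t.+1) Y s)
     - (T%:R - t%:R)^-1 *: (\sum_(t.+1 <= s < T.+1) Y s)).

Definition cusum_argmax (R : realType) (n T : nat) (Y : nat -> 'M[R]_n) :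
    set nat :=
  [set t | (1 <= t < T)%N /\
           forall s, (1 <= s < T)%N ->
             opnorm22 (cusum T Y s) <= opnorm22 (cusum T Y t)].

(* Main.v *)
(* Let N_t be the noise part of the matrix CUSUM statistic at time t, i.e. the
   statistic of the centred matrices Y^s - Pi.Theta^s, and let
   x = t / T, y = tau / T.

   Signal. The mean of the statistic is a multiple of Pi.dTheta, of norm
   sqrt T * q(x) * (1 - y) / (1 - x) * Delta for x <= y. By AM-GM on x and 1 - y,
   this norm drops from tau to t by at least sqrt T * q(y) * |x - y| * Delta, and
   likewise for x >= y. Comparing the statistic at tau and at its maximiser
   gives
     sqrt T * q(y) * |xhat - y| * Delta <= 2 max_t ||N_t||.

   Noise. It remains to see that max_t ||N_t|| <= 3 sqrt 2 sqrt omega + C log.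
   For m a power of two, ||N||^m <= tr N^m, and E tr N^m is a sum over closed
   walks whose steps carry a label s, the time of the variable Y^s - E Y^s used
   by the step. Only walks without a simply traversed labelled edge contribute,
   and each distinct labelled edge then contributes at most its variance. A
   dynamic-programming estimate bounds the sum of these contributions by
   n (3 sigma + 4 (m + 1))^m for every sigma > 0 with sigma^2 >= omega. Markov's
   inequality with a factor sqrt 2 per step and m of order log (2nT / gamma)
   concludes. *)

Require Import Defs.
From mathcomp Require Import all_boot all_order all_algebra.
From mathcomp Require Import zify ring lra.

Set Implicit Arguments.
Unset Strict Implicit.
Unset Printing Implicit Defensive.

Import Order.TTheory GRing.Theory Num.Theory.

Local Open Scope ring_scope.

(** * Weighted walks with labelled edges *)

Section Potential.
Variable V : finType.
Implicit Types (f g : V -> nat) (u v : V).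

(** Meant for [f x] the number of open edges counted at [x] and [u] the current vertex. A single
    counted edge leaves no choice, hence the predecessor. The indicator prepays the edge that a step
    to a new vertex opens at [u], which raises the sum exactly when [f u] is positive. *)
Definition walk_potential f u : nat := (\sum_x (f x).-1 + (0 < f u))%N.

Lemma sum_pred_split f u : (\sum_x (f x).-1 = (f u).-1 + \sum_(x | x != u) (f x).-1)%N.
Proof. by rewrite (bigD1 u). Qed.

(** Opening a tree edge: it is counted at the parent [u] only, and the indicator at [u] pays for it,
    while the indicator at the new vertex [v] vanishes. *)
Lemma walk_potential_open_tree f g u v : u != v -> f v = 0%N ->
  (forall x, g x = (f x + (x == u))%N) -> (walk_potential g v <= walk_potential f u)%N.
Proof.
move=> uv fv gE; rewrite /walk_potential !(sum_pred_split _ u).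
have -> : (\sum_(x | x != u) (g x).-1 = \sum_(x | x != u) (f x).-1)%N.
  by apply: eq_bigr => x xu; rewrite gE (negbTE xu) addn0.
by rewrite !gE eqxx fv eq_sym (negbTE uv); lia.
Qed.

Lemma sum_pred_split2 f u v : u != v ->
  (\sum_x (f x).-1 = (f u).-1 + ((f v).-1 + \sum_(x | (x != u) && (x != v)) (f x).-1))%N.
Proof. by move=> uv; rewrite (bigD1 u)//= (bigD1 v)//= eq_sym. Qed.

Lemma sum_pred_eq_off f g u v :
  (forall x, g x = (f x + (x == u) + (x == v))%N) ->
  (\sum_(x | (x != u) && (x != v)) (g x).-1
   = \sum_(x | (x != u) && (x != v)) (f x).-1)%N.
Proof.
by move=> gE; apply: eq_bigr => x /andP[/negbTE xu /negbTE xv]; rewrite gE xu xv !addn0.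
Qed.

Lemma walk_potential_open_cycle f g u v : u != v ->
  (forall x, g x = (f x + (x == u) + (x == v))%N) ->
  (walk_potential g v <= walk_potential f u + 2)%N.
Proof.
move=> uv gE; rewrite /walk_potential !(sum_pred_split2 _ uv) (sum_pred_eq_off gE).
by rewrite !gE !eqxx (negbTE uv) eq_sym (negbTE uv); lia.
Qed.

(** Closing a tree edge upwards: the parent [q] is the only end that loses a counted edge, and this
    loss pays for the indicator at [q]. *)
Lemma walk_potential_close_parent f g u q :
  (forall x, f x = (g x + (x == q))%N) ->
  (walk_potential g q <= walk_potential f u)%N.
Proof.
move=> fE; rewrite /walk_potential !(sum_pred_split _ q).
have -> : (\sum_(x | x != q) (f x).-1 = \sum_(x | x != q) (g x).-1)%N.
  by apply: eq_bigr => x xu; rewrite fE (negbTE xu) addn0.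
by rewrite (fE q) eqxx; lia.
Qed.

Lemma walk_potential_close_child f g u v :
  (forall x, f x = (g x + (x == u))%N) ->
  (walk_potential g v + (1 < f u) <= walk_potential f u)%N.
Proof.
move=> fE; rewrite /walk_potential !(sum_pred_split _ u).
have -> : (\sum_(x | x != u) (f x).-1 = \sum_(x | x != u) (g x).-1)%N.
  by apply: eq_bigr => x xu; rewrite fE (negbTE xu) addn0.
by rewrite (fE u) eqxx; lia.
Qed.

(** The loss at [v] pays for the new indicator at [v], so the old indicator at [u] is left over.
    This spare unit compensates one of the two factors [m] that closing a cycle edge removes from
    the denominator of [state_bound]. *)
Lemma walk_potential_close_cycle f g u v : u != v ->
  (forall x, f x = (g x + (x == u) + (x == v))%N) ->
  (walk_potential g v + 1 + (1 < f u) <= walk_potential f u)%N.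
Proof.
move=> uv fE; rewrite /walk_potential !(sum_pred_split2 _ uv) (sum_pred_eq_off fE).
by rewrite !fE !eqxx (negbTE uv) eq_sym (negbTE uv); lia.
Qed.

Lemma walk_potential_keep f u v : (walk_potential f v <= walk_potential f u + 1)%N.
Proof. by rewrite /walk_potential; lia. Qed.

Lemma walk_potential_keep_busy f u v : (0 < f u)%N ->
  (walk_potential f v <= walk_potential f u)%N.
Proof. by rewrite /walk_potential; lia. Qed.

End Potential.

Section Walks.
Variables (R : realFieldType) (V S : finType).
Local Notation E := (S * {set V})%type.
Variables (w : E -> R) (sg : R) (m : nat).
Hypothesis w_ge0 : forall e, 0 <= w e.
Hypothesis sg_gt0 : 0 < sg.
Hypothesis m_gt0 : (0 < m)%N.
Hypothesis w_row : forall u, \sum_v \sum_s w (s, [set u; v]) <= sg ^+ 2.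
Hypothesis w_cell : forall u v, \sum_s w (s, [set u; v]) <= 1.

Implicit Types (u v x : V) (s : S) (e : E) (Sn O : {set E}) (ch : E -> option V).

Fixpoint words k : seq (seq (V * S)) :=
  if k is k'.+1 then allpairs cons (enum {: V * S}) (words k') else [:: [::]].

(* [Sn] is the set of edges seen so far and [O] the subset of those that are
   still open, i.e. that will be traversed again. A fresh edge is opened, a step
   along an open edge either keeps it open or closes it for good; a walk has a
   way to close all its edges exactly when it traverses none of them once. *)
Fixpoint walk_weight u Sn O (l : seq (V * S)) : R :=
  if l is (v, s) :: l' then
    let e := (s, [set u; v]) in
    if u == v then 0 else
    if e \notin Sn then w e * walk_weight v (e |: Sn) (e |: O) l'
    else if e \in O then
      walk_weight v Sn O l' + walk_weight v Sn (O :\ e) l'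
    else 0
  else (O == set0)%:R.

(* An edge that was opened by a step to a new vertex [v] is a tree edge with
   child [v] ([ch e = Some v]); the other edges close a cycle ([ch e = None]).
   Only the edges counted by [incident] are ambiguous when leaving [x]: there is
   at most one open tree edge whose child is [x]. *)
Definition incident ch e x := (x \in e.2) && (ch e != Some x).
Definition open_count ch O x := #|[set e in O | incident ch e x]|.
Definition open_tree ch O := #|[set e in O | ch e]|.
Definition open_cycle ch O := #|[set e in O | ~~ ch e]|.
Definition set_child ch e (c : option V) e' := if e' == e then c else ch e'.

(* Closing an edge costs a choice only when several edges are open at [u], and
   each such choice lowers [walk_potential]. The potential is raised only by
   opening a cycle edge, by at most 2 (whence the denominator), and by
   traversing a tree edge upwards while keeping it open, by at most 1. *)
Definition state_bound ch O u : R :=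
  (sg ^+ open_tree ch O)^-1 * m%:R ^+ walk_potential (open_count ch O) u
  * (m%:R ^+ (open_cycle ch O).*2)^-1.

(** Invariant of a walk with [k] steps to go. Each step adds at most one vertex and one open edge,
    so the last two fields keep both numbers below [m], which bounds the choices at every step. *)
Record walk_state k u Sn O (vis : {set V}) ch : Prop := WalkState {
  ws_cur : u \in vis;
  ws_seen : O \subset Sn;
  ws_vis : forall e, e \in O -> e.2 \subset vis;
  ws_child : forall e x, e \in O -> ch e = Some x -> x \in e.2;
  ws_parent : forall e e' x, e \in O -> e' \in O ->
    ch e = Some x -> ch e' = Some x -> e = e';
  ws_size_vis : (#|vis| + k <= m)%N;
  ws_size_open : (#|O| + k <= m)%N }.

Lemma card_set_add (O : {set E}) e (p : pred E) : e \notin O ->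
  #|[set e' in e |: O | p e']| = (#|[set e' in O | p e']| + p e)%N.
Proof.
move=> eO; rewrite (cardsD1 e) !inE eqxx /= addnC; congr (_ + _)%N.
apply: eq_card => e'; rewrite !inE; case: eqVneq => //= ->; by rewrite (negbTE eO).
Qed.

Lemma card_set_del (O : {set E}) e (p : pred E) : e \in O ->
  #|[set e' in O | p e']| = (#|[set e' in O :\ e | p e']| + p e)%N.
Proof. by move=> eO; rewrite -card_set_add ?setD1K // !inE eqxx. Qed.

Lemma card_set_child (O : {set E}) e c ch (p : option V -> E -> bool) : e \notin O ->
  #|[set e' in O | p (set_child ch e c e') e']| = #|[set e' in O | p (ch e') e']|.
Proof.
move=> eO; apply: eq_card => e'; rewrite !inE /set_child; case: eqVneq => // ->.
by rewrite (negbTE eO).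
Qed.

Section Step.
Variables (k : nat) (u v : V) (s : S) (Sn O : {set E}) (vis : {set V}).
Variable ch : E -> option V.
Local Notation e := (s, [set u; v]).
Hypothesis st : walk_state k.+1 u Sn O vis ch.
Hypothesis uv : u != v.

Let m_ge1 : 1 <= m%:R :> R. Proof. by rewrite ler1n. Qed.
Let m_gt0R : 0 < m%:R :> R. Proof. by rewrite ltr0n. Qed.
Let m_ge0 : 0 <= m%:R :> R. Proof. exact: ltW. Qed.
Let sg_ge0 : 0 <= sg. Proof. exact: ltW. Qed.
Let m_neq0 : m%:R != 0 :> R. Proof. by rewrite gt_eqF. Qed.

Lemma state_bound_ge0 ch' O' x : 0 <= state_bound ch' O' x.
Proof. by rewrite /state_bound !mulr_ge0 // ?invr_ge0 ?exprn_ge0 // ltW. Qed.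

Lemma open_count_open c x : e \notin O ->
  open_count (set_child ch e c) (e |: O) x =
  (open_count ch O x + (x \in [set u; v]) * (c != Some x))%N.
Proof.
move=> eO; rewrite /open_count card_set_add //.
rewrite (card_set_child c ch (fun o e' => (x \in e'.2) && (o != Some x))) //.
by rewrite /incident /set_child eqxx -mulnb.
Qed.

Lemma open_count_close x : e \in O ->
  open_count ch O x =
  (open_count ch (O :\ e) x + (x \in [set u; v]) * (ch e != Some x))%N.
Proof. by move=> eO; rewrite /open_count (card_set_del _ eO) /incident -mulnb. Qed.

Lemma open_count_notin_vis x : x \notin vis -> open_count ch O x = 0%N.
Proof.
move=> xv; apply/eqP; rewrite cards_eq0 -subset0; apply/subsetP => e'.
rewrite inE => /andP[e'O /andP[xe _]].
by move/subsetP: (ws_vis st e'O) => /(_ _ xe); rewrite (negbTE xv).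
Qed.

(** The weight of a tree edge is shared between its two ends in time: with the factor [sg^-1], the
    row bound [sg ^+ 2] sums to [sg] over the new vertices, and the other factor [sg] is spent when
    the edge is closed. *)
Lemma step_open_tree : e \notin Sn -> v \notin vis ->
  walk_state k v (e |: Sn) (e |: O) (v |: vis) (set_child ch e (Some v)) /\
  state_bound (set_child ch e (Some v)) (e |: O) v <= sg^-1 * state_bound ch O u.
Proof.
move=> eSn vvis.
have eO : e \notin O by apply: contra eSn => /(subsetP (ws_seen st)).
split.
  split.
  - by rewrite setU11.
  - exact: setUS (ws_seen st).
  - move=> e'; rewrite !inE => /orP[/eqP->|/(ws_vis st) h].
      rewrite /= subUset !sub1set setU11 andbT !inE (ws_cur st) orbT //.
    exact: subset_trans h (subsetUr _ _).
  - move=> e' x; rewrite !inE /set_child; case: eqVneq => [-> _ [<-]|_ /= h].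
      by rewrite !inE eqxx orbT.
    exact: ws_child st _ _ h.
  - move=> e1 e2 x; rewrite !inE /set_child; case: eqVneq => [->|_] /=;
      case: eqVneq => [->|_] //=.
    + move=> _ e2O [<-] /(ws_child st e2O) => h.
      by move/subsetP: (ws_vis st e2O) => /(_ _ h); rewrite (negbTE vvis).
    + move=> e1O _ /(ws_child st e1O) + [xv]; rewrite -xv => h.
      by move/subsetP: (ws_vis st e1O) => /(_ _ h); rewrite (negbTE vvis).
    + exact: ws_parent st _ _ _.
  - by rewrite cardsU1 vvis add1n addSnnS (ws_size_vis st).
  - by rewrite cardsU1 eO add1n addSnnS (ws_size_open st).
rewrite /state_bound /open_tree /open_cycle !card_set_add //.
rewrite (card_set_child (Some v) ch (fun o _ => isSome o)) //.
rewrite (card_set_child (Some v) ch (fun o _ => ~~ isSome o)) //.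
rewrite /set_child eqxx /= addn0 addn1 exprS invfM -!mulrA ler_wpM2l ?invr_ge0 //.
rewrite !ler_wpM2l ?invr_ge0 ?exprn_ge0 // ler_wpM2r ?invr_ge0 ?exprn_ge0 //.
rewrite ler_weXn2l //; apply: walk_potential_open_tree uv (open_count_notin_vis vvis) _.
move=> x; rewrite (open_count_open _ _ eO) !inE; congr (_ + _)%N.
case: (eqVneq x u) => [->|_]; first by rewrite (inj_eq Some_inj) (eq_sym v) uv.
by case: (eqVneq x v) => [->|_]; rewrite ?eqxx.
Qed.

(** Here the cell bound replaces the row bound: there are at most [m] visited vertices to return to,
    each of total weight at most 1 over the labels. *)
Lemma step_open_cycle : e \notin Sn -> v \in vis ->
  walk_state k v (e |: Sn) (e |: O) vis (set_child ch e None) /\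
  state_bound (set_child ch e None) (e |: O) v <= state_bound ch O u.
Proof.
move=> eSn vvis.
have eO : e \notin O by apply: contra eSn => /(subsetP (ws_seen st)).
split.
  split => //.
  - exact: setUS (ws_seen st).
  - move=> e'; rewrite !inE => /orP[/eqP->|/(ws_vis st) //].
    by rewrite /= subUset !sub1set (ws_cur st).
  - move=> e' x; rewrite !inE /set_child; case: eqVneq => [-> //|_ /= h].
    exact: ws_child st _ _ h.
  - move=> e1 e2 x; rewrite !inE /set_child.
    case: eqVneq => [-> //|_] /=; case: eqVneq => [->//|_] /=.
    exact: ws_parent st _ _ _.
  - by apply: leq_trans (ws_size_vis st); rewrite leq_add2l.
  - by rewrite cardsU1 eO add1n addSnnS (ws_size_open st).
rewrite /state_bound /open_tree /open_cycle !card_set_add //.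
rewrite (card_set_child None ch (fun o _ => isSome o)) //.
rewrite (card_set_child None ch (fun o _ => ~~ isSome o)) //.
rewrite /set_child eqxx /= addn0 addn1 -!mulrA ler_wpM2l ?invr_ge0 ?exprn_ge0 //.
rewrite ler_pdivrMr ?exprn_gt0 // mulrAC -mulrA -exprB ?unitfE ?gt_eqF //;
  last by rewrite leq_double.
rewrite -doubleB subSnn -exprD ler_weXn2l //.
apply: walk_potential_open_cycle uv _ => x.
rewrite (open_count_open _ _ eO) !inE -addnA; congr (_ + _)%N.
case: (eqVneq x u) => [->|_]; first by rewrite (negbTE uv).
by case: (eqVneq x v).
Qed.

(** A factor [m] is affordable for the tree edge with child [u], as there is at most one; the
    counted edges, of which there may be [m], must be kept at no cost. *)
Lemma step_keep : e \in O ->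
  walk_state k v Sn O vis ch /\
  state_bound ch O v <= m%:R * state_bound ch O u /\
  (incident ch e u -> state_bound ch O v <= state_bound ch O u).
Proof.
move=> eO; split.
  case: (st) => ws_cur0 ws_seen0 ws_vis0 ws_child0 ws_parent0 ws_size_vis0 ws_size_open0.
  split => //; last 2 first.
  - by rewrite (leq_trans _ ws_size_vis0) // leq_add2l.
  - by rewrite (leq_trans _ ws_size_open0) // leq_add2l.
  by apply: (subsetP (ws_vis0 _ eO)); rewrite !inE eqxx orbT.
split => [|inc]; rewrite /state_bound.
  rewrite mulrA (mulrCA m%:R) -exprS ler_wpM2r ?invr_ge0 ?exprn_ge0 //.
  rewrite ler_wpM2l ?invr_ge0 ?exprn_ge0 // ler_weXn2l // -addn1.
  exact: walk_potential_keep.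
rewrite ler_wpM2r ?invr_ge0 ?exprn_ge0 //.
rewrite ler_wpM2l ?invr_ge0 ?exprn_ge0 // ler_weXn2l //.
apply: walk_potential_keep_busy; rewrite /open_count card_gt0; apply/set0Pn.
by exists e; rewrite inE eO.
Qed.

(** Dividing by the number of edges counted at [u] makes the choice among them cost [sg + m] in
    total: [sg] serves a tree edge traversed downwards, [m] a cycle edge. *)
Lemma step_close : e \in O ->
  walk_state k v Sn (O :\ e) vis ch /\
  (ch e = Some u -> state_bound ch (O :\ e) v <= sg * state_bound ch O u) /\
  (incident ch e u -> state_bound ch (O :\ e) v
     <= (sg + m%:R) / (open_count ch O u)%:R * state_bound ch O u).
Proof.
move=> eO; split.
  case: (st) => ws_cur0 ws_seen0 ws_vis0 ws_child0 ws_parent0 ws_size_vis0 ws_size_open0.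
  split => //.
  - by apply: (subsetP (ws_vis0 _ eO)); rewrite !inE eqxx orbT.
  - exact: subset_trans (subsetDl _ _) ws_seen0.
  - by move=> e' /setD1P[_]; exact: ws_vis0.
  - by move=> e' x /setD1P[_]; exact: ws_child0.
  - by move=> e1 e2 x /setD1P[_ h1] /setD1P[_]; exact: ws_parent0.
  - by rewrite (leq_trans _ ws_size_vis0) // leq_add2l.
  - rewrite (leq_trans _ ws_size_open0) // leq_add //.
    exact: subset_leq_card (subsetDl _ _).
rewrite /state_bound /open_tree /open_cycle !(card_set_del _ eO).
set t := #|[set e' in O :\ e | ch e']|; set q := #|[set e' in O :\ e | ~~ ch e']|.
split => [che|].
  rewrite che /= addn0 addn1 exprS invfM -!mulrA mulVKf ?gt_eqF //.
  rewrite ler_wpM2l ?invr_ge0 ?exprn_ge0 // ler_wpM2r ?invr_ge0 ?exprn_ge0 //.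
  rewrite ler_weXn2l //; apply: walk_potential_close_parent => x.
  rewrite (open_count_close _ eO) che !inE; congr (_ + _)%N.
  case: (eqVneq x u) => [->|xu]; first by rewrite eqxx muln0 (negbTE uv).
  by rewrite (inj_eq Some_inj) (eq_sym u) xu muln1.
move=> inc; set d := open_count ch O u.
have d_gt0 : (0 < d)%N.
  by rewrite /d /open_count card_gt0; apply/set0Pn; exists e; rewrite inE eO.
have d_le : (d <= m)%N.
  apply: leq_trans (leq_trans (leq_addr _ _) (ws_size_open st)).
  by apply: subset_leq_card; apply/subsetP => x; rewrite inE => /andP[].
have d_gt0R : 0 < d%:R :> R by rewrite ltr0n.
(* The division by [d] will be paid by the unit of potential lost when [1 < d]. *)
have dm : d%:R <= m%:R ^+ (1 < d) :> R.
  by case: (d) d_gt0 d_le => [//|[|d']] _ d'm /=; rewrite ?expr0 ?expr1 ?ler_nat.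
set p := walk_potential (open_count ch (O :\ e)) v.
set p' := walk_potential (open_count ch O) u.
case che : (ch e) => [c|] /=.
  (* A tree edge counted at [u] does not have [u] as its child, so it leads down to [v]. *)
  have cv : c = v.
    have := ws_child st eO che; rewrite !inE => /orP[/eqP cu|/eqP //].
    by move: inc; rewrite /incident che cu eqxx andbF.
  have pp : (p + (1 < d) <= p')%N.
    apply: walk_potential_close_child => x.
    rewrite (open_count_close _ eO) che !inE; congr (_ + _)%N.
    rewrite (inj_eq Some_inj) cv eq_sym.
    by case: (eqVneq x u) => [->|xu]; [rewrite (eq_sym v) uv|case: (eqVneq x v)].
  rewrite addn0 addn1 exprS invfM.
  have le_p : m%:R ^+ p <= m%:R ^+ p' / d%:R :> R.
    rewrite ler_pdivlMr // (le_trans _ (ler_weXn2l _ pp)) // exprD.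
    by rewrite ler_wpM2l ?exprn_ge0.
  rewrite (le_trans (y := (sg ^+ t)^-1 * (m%:R ^+ p' / d%:R) * (m%:R ^+ q.*2)^-1)) //.
    by rewrite ler_wpM2r ?invr_ge0 ?exprn_ge0 // ler_wpM2l ?invr_ge0 ?exprn_ge0.
  have [t0 q0] : 0 <= (sg ^+ t)^-1 /\ 0 <= (m%:R ^+ q.*2)^-1 :> R.
    by rewrite !invr_ge0 !exprn_ge0.
  have p0 : 0 <= m%:R ^+ p' :> R by rewrite exprn_ge0.
  move: (_ ^-1) t0 (_ ^-1) q0 (_ ^+ p') p0 => X X0 Y Y0 Z Z0.
  rewrite (_ : _ * Y = sg / d%:R * (sg^-1 * X * Z * Y)); last first.
    by field; rewrite !gt_eqF.
  rewrite ler_wpM2r ?mulr_ge0 ?invr_ge0 // ler_wpM2r ?invr_ge0 ?ler0n //.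
  by rewrite lerDl.
have pp : (p + 1 + (1 < d) <= p')%N.
  apply: walk_potential_close_cycle uv _ => x.
  rewrite (open_count_close _ eO) che !inE muln1 -addnA; congr (_ + _)%N.
  by case: (eqVneq x u) => [->|xu]; [rewrite (negbTE uv)|case: (eqVneq x v)].
rewrite addn0 addn1 doubleS 2!exprS !invfM.
have le_p : m%:R ^+ p <= m%:R ^+ p' / m%:R / d%:R :> R.
  rewrite ler_pdivlMr // ler_pdivlMr // (le_trans _ (ler_weXn2l _ pp)) // !exprD expr1.
  by rewrite -mulrA (mulrC d%:R) mulrA ler_wpM2l ?mulr_ge0 ?exprn_ge0.
rewrite (le_trans (y := (sg ^+ t)^-1 * (m%:R ^+ p' / m%:R / d%:R) * (m%:R ^+ q.*2)^-1)) //.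
  by rewrite ler_wpM2r ?invr_ge0 ?exprn_ge0 // ler_wpM2l ?invr_ge0 ?exprn_ge0.
have [t0 q0] : 0 <= (sg ^+ t)^-1 /\ 0 <= (m%:R ^+ q.*2)^-1 :> R.
  by rewrite !invr_ge0 !exprn_ge0.
have p0 : 0 <= m%:R ^+ p' :> R by rewrite exprn_ge0.
rewrite /=; move: (_ ^-1) t0 (_ ^-1) q0 (_ ^+ p') p0 => X X0 Y Y0 Z Z0.
rewrite (_ : X * _ * Y = m%:R / d%:R * (X * Z * (m%:R^-1 * (m%:R^-1 * Y)))); last first.
  by field; rewrite m_neq0 gt_eqF.
rewrite ler_wpM2r ?mulr_ge0 ?invr_ge0 // ler_wpM2r ?invr_ge0 ?ler0n //.
by rewrite lerDr.
Qed.

End Step.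

(** Once [u] is fixed and loops are excluded, a labelled edge determines the step along it. *)
Lemma sum_steps_le u (P : pred E) (F : E -> R) : (forall e, 0 <= F e) ->
  \sum_(y : V * S | (u != y.1) && P (y.2, [set u; y.1])) F (y.2, [set u; y.1])
  <= \sum_(e | P e) F e.
Proof.
move=> F0; pose h (y : V * S) : E := (y.2, [set u; y.1]).
pose A := [set y : V * S | (u != y.1) && P (h y)].
rewrite [leLHS](_ : _ = \sum_(y in A) F (h y)); last first.
  by apply: eq_bigl => y; rewrite inE.
rewrite -(big_imset F) /=; last first.
  move=> [v s] [v' s']; rewrite !inE /= => /andP[uv _] /andP[uv' _] [-> vv'].
  congr (_, _); have : v \in [set u; v'] by rewrite -vv' !inE eqxx orbT.
  by rewrite !inE eq_sym (negbTE uv) => /eqP.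
rewrite big_mkcond [leRHS]big_mkcond; apply: ler_sum => e _.
by case: imsetP => [[y]|_]; [rewrite inE => /andP[_ +] -> => ->|case: ifP].
Qed.

(** Induction on the number of remaining steps. The next step falls into one of four classes: to a
    new vertex ([T1], total at most [sg]), along a fresh edge to a visited vertex ([T2], at most
    [m]), along the single open edge with child [u] ([T3], at most [sg + m]), or along an edge
    counted at [u] ([T4], at most [sg + m] for closing and [m] for keeping). These add up to
    [3 * sg + 4 * m]. *)
Lemma walk_sum_le k u Sn O vis ch : walk_state k u Sn O vis ch ->
  \sum_(l <- words k) walk_weight u Sn O l
  <= (3 * sg + 4 * m%:R) ^+ k * state_bound ch O u.
Proof.
have sg_ge0 : 0 <= sg := ltW sg_gt0.
elim: k u Sn O vis ch => [|k IH] u Sn O vis ch st.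
  rewrite big_seq1 expr0 mul1r /=; case: eqP => [->|_]; last exact: state_bound_ge0.
  have z0 (P : pred E) : #|[set e in set0 : {set E} | P e]| = 0%N.
    by apply/eqP; rewrite cards_eq0; apply/eqP/setP => e; rewrite !inE.
  rewrite /state_bound /open_tree /open_cycle /walk_potential /open_count !z0 /=.
  rewrite expr0 invr1 mul1r mulr1 addn0 big1 ?expr0 ?invr1 ?mulr1 // => x _.
  by rewrite z0.
set B := state_bound ch O u; have B0 : 0 <= B by exact: state_bound_ge0.
set A := 3 * sg + 4 * m%:R; have A0 : 0 <= A by rewrite addr_ge0 ?mulr_ge0.
rewrite /= big_allpairs_dep /= big_enum /=.
pose d := open_count ch O u.
pose T1 (y : V * S) := if y.1 \in vis then 0 else w (y.2, [set u; y.1]) / sg.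
pose T2 (y : V * S) := if y.1 \in vis then w (y.2, [set u; y.1]) else 0.
pose par e := (e \in O) && (ch e == Some u).
pose inc e := (e \in O) && incident ch e u.
pose T3 (y : V * S) :=
  if (u != y.1) && par (y.2, [set u; y.1]) then sg + m%:R else 0.
pose T4 (y : V * S) :=
  if (u != y.1) && inc (y.2, [set u; y.1]) then (sg + m%:R) / d%:R + 1 else 0.
apply: (@le_trans _ _ (A ^+ k * (\sum_y (T1 y + T2 y + T3 y + T4 y) * B))); last first.
  rewrite exprSr -mulrA ler_wpM2l ?exprn_ge0 // -mulr_suml ler_wpM2r //.
  rewrite !big_split /= (_ : A = sg + m%:R + (sg + m%:R) + (sg + m%:R + m%:R)); last first.
    by rewrite /A; ring.
  apply: lerD; [apply: lerD; [apply: lerD|]|].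
  - rewrite -[leRHS](mulfK (x := sg)) ?gt_eqF // -expr2.
    rewrite (le_trans (y := (\sum_v \sum_s w (s, [set u; v])) / sg)) ?ler_pM2r ?invr_gt0 //.
    rewrite pair_big /= mulr_suml; apply: ler_sum => y _; rewrite /T1.
    by case: ifP => // _; rewrite divr_ge0.
  - rewrite (le_trans (y := \sum_(v in vis) \sum_s w (s, [set u; v]))) //.
      rewrite pair_big_dep /= [leRHS]big_mkcond /=; apply: ler_sum => y _.
      by rewrite /T2 andbT.
    rewrite (le_trans (ler_sum _ (fun v _ => w_cell u v))) // sumr_const ler_nat.
    exact: leq_trans (leq_addr _ _) (ws_size_vis st).
  - rewrite -big_mkcond (le_trans (sum_steps_le u par (F := fun=> sg + m%:R) _)) //.
      by move=> _; rewrite addr_ge0.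
    rewrite sumr_const -[leRHS]mulr1n ler_wpMn2l ?addr_ge0 //.
    apply/card_le1_eqP => e e' /andP[eO /eqP ce] /andP[eO' /eqP ce'].
    exact: ws_parent st e' e u eO' eO ce' ce.
  - rewrite -big_mkcond (le_trans (sum_steps_le u inc (F := fun=> (sg + m%:R) / d%:R + 1) _)) //.
      by move=> _; rewrite addr_ge0 ?divr_ge0 ?addr_ge0.
    rewrite sumr_const (_ : #|inc| = d); last by rewrite /d /open_count cardsE.
    have d_le : d%:R <= m%:R :> R.
      rewrite ler_nat (leq_trans _ (leq_trans (leq_addr _ _) (ws_size_open st))) //.
      by apply: subset_leq_card; apply/subsetP => e; rewrite inE => /andP[].
    have [d0|d_gt0] := posnP d; first by rewrite d0 mulr0n !addr_ge0.
    by rewrite -[leLHS]mulr_natr mulrDl mul1r divfK ?lerD2l // pnatr_eq0 -lt0n.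
have T34 : [/\ forall y, 0 <= T1 y, forall y, 0 <= T2 y, forall y, 0 <= T3 y
    & forall y, 0 <= T4 y].
  split=> y; rewrite /T1 /T2 /T3 /T4; case: ifP => _ //.
  - by rewrite divr_ge0.
  - by rewrite addr_ge0.
  - by rewrite addr_ge0 ?divr_ge0 ?addr_ge0.
case: T34 => T1_0 T2_0 T3_0 T4_0.
rewrite mulr_sumr; apply: ler_sum => -[v s] _ /=.
have Ak0 : 0 <= A ^+ k by rewrite exprn_ge0.
have T0 : 0 <= T1 (v, s) + T2 (v, s) + T3 (v, s) + T4 (v, s) by rewrite !addr_ge0.
have TB0 : 0 <= A ^+ k * ((T1 (v, s) + T2 (v, s) + T3 (v, s) + T4 (v, s)) * B).
  by rewrite mulr_ge0 // mulr_ge0.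
have [uv|uv] := eqVneq u v; first by rewrite big1.
have [eSn|eSn] /= := boolP ((s, [set u; v]) \notin Sn).
  rewrite -mulr_sumr.
  have [vvis|vvis] := boolP (v \in vis).
    have [st' le'] := step_open_cycle st uv eSn vvis.
    apply: (@le_trans _ _ (w (s, [set u; v]) * (A ^+ k * B))).
      by rewrite ler_wpM2l // (le_trans (IH _ _ _ _ _ st')) // ler_wpM2l.
    rewrite mulrCA ler_wpM2l // ler_wpM2r //.
    have -> : w (s, [set u; v]) = T2 (v, s) by rewrite /T2 vvis.
    by move: (T1_0 (v, s)) (T3_0 (v, s)) (T4_0 (v, s)); lra.
  have [st' le'] := step_open_tree st uv eSn vvis.
  apply: (@le_trans _ _ (w (s, [set u; v]) * (A ^+ k * (sg^-1 * B)))).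
    by rewrite ler_wpM2l // (le_trans (IH _ _ _ _ _ st')) // ler_wpM2l.
  rewrite mulrCA ler_wpM2l // mulrA ler_wpM2r //.
  have -> : w (s, [set u; v]) / sg = T1 (v, s) by rewrite /T1 (negbTE vvis).
  by move: (T2_0 (v, s)) (T3_0 (v, s)) (T4_0 (v, s)); lra.
have [eO|eO] := boolP ((s, [set u; v]) \in O); last by rewrite big1.
rewrite big_split /=.
have [kst [kle kle']] := step_keep st eO.
have [cst [cle cle']] := step_close st uv eO.
apply: (@le_trans _ _ (A ^+ k *
    (state_bound ch O v + state_bound ch (O :\ (s, [set u; v])) v))).
  by rewrite mulrDr lerD // (IH _ _ _ _ _ kst, IH _ _ _ _ _ cst).
rewrite ler_wpM2l //.
have [cu|cu] := eqVneq (ch (s, [set u; v])) (Some u).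
  apply: (@le_trans _ _ (T3 (v, s) * B)).
    by rewrite /T3 /= uv /par eO cu eqxx /= mulrDl addrC lerD // cle.
  by rewrite ler_wpM2r //; move: (T1_0 (v, s)) (T2_0 (v, s)) (T4_0 (v, s)); lra.
have inc_e : incident ch (s, [set u; v]) u by rewrite /incident cu !inE eqxx.
apply: (@le_trans _ _ (T4 (v, s) * B)).
  by rewrite /T4 /= uv /inc eO inc_e /= mulrDl mul1r addrC lerD // (cle', kle').
by rewrite ler_wpM2r //; move: (T1_0 (v, s)) (T2_0 (v, s)) (T3_0 (v, s)); lra.
Qed.

(** The inequality on [k] is strict because the starting vertex already counts as visited. *)
Lemma empty_walk_sum_le k u : (k < m)%N ->
  \sum_(l <- words k) walk_weight u set0 set0 l <= (3 * sg + 4 * m%:R) ^+ k.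
Proof.
move=> km.
have st : walk_state k u set0 set0 [set u] (fun=> None).
  split; rewrite ?inE ?cards1 ?cards0 ?add0n //; try by [move=> ?; rewrite inE].
  exact: ltnW.
rewrite (le_trans (walk_sum_le st)) // ler_piMr //.
  by rewrite exprn_ge0 // addr_ge0 ?mulr_ge0 // ltW.
have z0 (P : pred E) : #|[set e in set0 : {set E} | P e]| = 0%N.
  by apply/eqP; rewrite cards_eq0; apply/eqP/setP => e; rewrite !inE.
rewrite /state_bound /open_tree /open_cycle /walk_potential /open_count !z0 /=.
by rewrite expr0 invr1 mul1r mulr1 addn0 big1 // => x _; rewrite z0.
Qed.

End Walks.

Lemma prod_seq_count (R : comNzRingType) (I : finType) (F : I -> R) (r : seq I) :
  \prod_(i <- r) F i = \prod_i F i ^+ count_mem i r.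
Proof.
elim: r => [|x r IH]; first by rewrite big_nil big1 // => i _; rewrite expr0.
rewrite big_cons IH (bigD1 x) //= [RHS](bigD1 x) //= eqxx exprS mulrA; congr (_ * _).
by apply: eq_bigr => i /negbTE ix; rewrite eq_sym ix add0n.
Qed.

(** * Moments of the noise matrix *)

Section ProductExpectation.
Variables (R : comNzRingType) (J T : finType) (mu : J -> T -> R).

(** Moments are computed on a finite product space, where expectations are sums; [outcome_prob]
    later relates it to the given probability. *)
Definition prod_weight (z : {ffun J -> T}) : R := \prod_j mu j (z j).
Definition prod_mean (f : {ffun J -> T} -> R) : R := \sum_z prod_weight z * f z.

Lemma prod_mean_prod (F : J -> T -> R) :
  prod_mean (fun z => \prod_j F j (z j)) = \prod_j \sum_t mu j t * F j t.
Proof.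
rewrite bigA_distr_bigA; apply: eq_bigr => z _.
by rewrite /prod_weight -big_split.
Qed.

Lemma prod_mean_sum (I : Type) (r : seq I) (P : pred I) f :
  prod_mean (fun z => \sum_(i <- r | P i) f i z) = \sum_(i <- r | P i) prod_mean (f i).
Proof.
rewrite /prod_mean exchange_big /=.
by apply: eq_bigr => z _; rewrite mulr_sumr.
Qed.

Lemma sum_prod_weight : (forall j, \sum_t mu j t = 1) -> \sum_z prod_weight z = 1.
Proof. by move=> mu1; rewrite -bigA_distr_bigA big1. Qed.

End ProductExpectation.

Section TraceMoment.
Variables (R : realFieldType) (n : nat) (S T : finType).
Local Notation V := 'I_n.
Local Notation E := (S * {set V})%type.
Variables (mu : E -> T -> R) (X : E -> T -> R) (w : E -> R).
Hypothesis mean0 : forall e, \sum_t mu e t * X e t = 0.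
Hypothesis mass1 : forall e, \sum_t mu e t = 1.
Hypothesis moment : forall e k, `|\sum_t mu e t * X e t ^+ k.+2| <= w e.
Hypothesis w_loop : forall s u, w (s, [set u; u]) = 0.

Fixpoint walk_edges (u : V) (l : seq (V * S)) : seq E :=
  if l is (v, s) :: l' then (s, [set u; v]) :: walk_edges v l' else [::].

Definition moment_bound e k : R :=
  if k is k'.+1 then if k' is 0 then 0 else w e else 1.

Lemma w_ge0 e : 0 <= w e.
Proof. exact: le_trans (normr_ge0 _) (moment e 0). Qed.

Lemma momentP e k : `|\sum_t mu e t * X e t ^+ k| <= moment_bound e k.
Proof.
case: k => [|[|k]] /=; last exact: moment.
- by under eq_bigr do rewrite expr0 mulr1; rewrite mass1 normr1.
- by under eq_bigr do rewrite expr1; rewrite mean0 normr0.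
Qed.

Lemma walk_weight_ge0 u Sn O l : 0 <= walk_weight w u Sn O l.
Proof.
elim: l u Sn O => [|[v s] l IH] u Sn O //=.
case: ifP => // _; case: ifP => _; first by rewrite mulr_ge0 ?w_ge0.
by case: ifP => // _; rewrite addr_ge0.
Qed.

(** The hypotheses say that [O] consists of the seen edges which the rest of the walk uses again. At
    an open edge, the branch that agrees with the rest of the walk carries the bound and the other
    one is merely nonnegative. A fresh edge that does not recur is used once, so its mean makes the
    left side vanish. *)
Lemma moment_walk_weight u (Sn O : {set E}) l : O \subset Sn ->
  (forall s x, (s, [set x; x]) \notin O) ->
  {subset O <= walk_edges u l} ->
  (forall e, e \in walk_edges u l -> e \in Sn -> e \in O) ->
  \prod_(e | e \notin Sn) moment_bound e (count_mem e (walk_edges u l))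
    <= walk_weight w u Sn O l.
Proof.
elim: l u Sn O => [|[v s] l IH] u Sn O OSn Oloop Ol lO /=.
  rewrite big1 // (_ : O = set0) ?eqxx //.
  by apply/setP => e; rewrite inE; apply/negP => /Ol.
set e0 := (s, [set u; v]).
have split0 : e0 \notin Sn -> \prod_(e | e \notin Sn)
     moment_bound e ((e0 == e) + count_mem e (walk_edges v l)) =
   moment_bound e0 (count_mem e0 (walk_edges v l)).+1 *
   \prod_(e | e \notin e0 |: Sn) moment_bound e (count_mem e (walk_edges v l)).
  move=> e0Sn; rewrite (bigD1 e0) //= eqxx; congr (_ * _).
  by apply: eq_big => [e|e /andP[_ /negbTE]]; rewrite ?inE ?negb_or 1?andbC // eq_sym => ->.
(* A loop is never open, hence it is fresh; its bound is zero by the mean if it is used once and by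
   [w_loop] otherwise. *)
case: ifP => [/eqP uv|uv].
  have e0O : e0 \notin O by rewrite /e0 uv.
  have e0Sn : e0 \notin Sn.
    by apply: contra e0O => h; apply: lO => //=; rewrite inE eqxx.
  rewrite split0 // (_ : moment_bound e0 _ = 0) ?mul0r //.
  by rewrite /= /e0 uv w_loop; case: count.
case: ifP => [e0Sn|/negbFE e0Sn].
  rewrite split0 //.
  have [e0l|e0l] := boolP (e0 \in walk_edges v l); last first.
    by rewrite (count_memPn e0l) /= mul0r mulr_ge0 ?w_ge0 ?walk_weight_ge0.
  have : (0 < count_mem e0 (walk_edges v l))%N by rewrite -has_count has_pred1.
  case: (count _ _) => // c _ /=; rewrite ler_wpM2l ?w_ge0 //; apply: IH.
  - exact: setUS.
  - move=> s' x; rewrite !inE negb_or Oloop andbT; apply/eqP => -[_ xx].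
    have : u \in [set x; x] by rewrite xx !inE eqxx.
    have : v \in [set x; x] by rewrite xx !inE eqxx orbT.
    by rewrite !inE !orbb => /eqP vx /eqP ux; rewrite ux vx eqxx in uv.
  - move=> e; rewrite !inE => /orP[/eqP -> //|eO].
    have := Ol _ eO; rewrite /= inE => /orP[/eqP ee|//].
    by move: (subsetP OSn _ eO); rewrite ee (negbTE e0Sn).
  - by move=> e el; rewrite !inE => /orP[->//|h]; rewrite lO ?orbT //= inE el orbT.
case: ifP => e0O; last first.
  by move: (lO e0); rewrite /= inE eqxx e0O => /(_ isT e0Sn).
have -> : \prod_(e | e \notin Sn) moment_bound e ((e0 == e) + count_mem e (walk_edges v l))
  = \prod_(e | e \notin Sn) moment_bound e (count_mem e (walk_edges v l)).
  by apply: eq_bigr => e eSn; case: eqVneq => // ee; rewrite -ee e0Sn in eSn.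
have [e0l|e0l] := boolP (e0 \in walk_edges v l).
  rewrite -[leLHS]addr0 lerD ?walk_weight_ge0 //; apply: IH => //.
  - by move=> e /Ol; rewrite /= inE => /orP[/eqP ->|].
  - by move=> e el; apply: lO; rewrite /= inE el orbT.
rewrite -[leLHS]add0r lerD ?walk_weight_ge0 //; apply: IH => //.
- exact: subset_trans (subsetDl _ _) OSn.
- by move=> s' x; rewrite !inE (negbTE (Oloop _ _)) andbF.
- by move=> e /setD1P[ee /Ol]; rewrite /= inE (negbTE ee).
- move=> e el eSn; rewrite !inE lO ?andbT //=; last by rewrite inE el orbT.
  by apply: contraNneq e0l => <-.
Qed.

Definition noise_mx (z : {ffun E -> T}) : 'M[R]_n :=
  \matrix_(u, v) \sum_s X (s, [set u; v]) (z (s, [set u; v])).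

Definition mxpow (A : 'M[R]_n) k : 'M[R]_n := iter k (mulmx A) 1%:M.

Lemma mxpow_walks z k u v : mxpow (noise_mx z) k u v =
  \sum_(l <- words V S k | last u [seq y.1 | y <- l] == v)
    \prod_(e <- walk_edges u l) X e (z e).
Proof.
elim: k u => [|k IH] u; first by rewrite big_mkcond big_seq1 big_nil mxE /=; case: eqP.
rewrite /= mxE [RHS]big_mkcond big_allpairs_dep /= big_enum /=.
transitivity (\sum_x \sum_s \sum_(l <- words V S k)
  if last x [seq y.1 | y <- l] == v
  then \prod_(e <- (s, [set u; x]) :: walk_edges x l) X e (z e) else 0); last first.
  by rewrite pair_bigA; apply: eq_bigr => -[].
apply: eq_bigr => x _; rewrite mxE big_distrl /=; apply: eq_bigr => s _.
rewrite IH big_distrr /= -big_mkcond; apply: eq_bigr => l _.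
by rewrite big_cons.
Qed.

(** By independence the mean splits into one moment per labelled edge, of order the multiplicity of
    that edge in the walk. *)
Lemma prod_mean_walk u l :
  prod_mean mu (fun z => \prod_(e <- walk_edges u l) X e (z e))
  <= walk_weight w u set0 set0 l.
Proof.
have -> : prod_mean mu (fun z => \prod_(e <- walk_edges u l) X e (z e)) =
  prod_mean mu (fun z => \prod_e X e (z e) ^+ count_mem e (walk_edges u l)).
  by apply: eq_bigr => z _; rewrite prod_seq_count.
rewrite (prod_mean_prod mu (fun e t => X e t ^+ count_mem e (walk_edges u l))).
apply: le_trans (ler_norm _) _; rewrite normr_prod.
apply: (@le_trans _ _ (\prod_e moment_bound e (count_mem e (walk_edges u l)))).
  by apply: ler_prod => e _; rewrite normr_ge0 momentP.
rewrite (eq_bigl (fun e => e \notin set0)); last by move=> e; rewrite inE.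
by apply: moment_walk_weight => [|s x|e|e _]; rewrite ?sub0set ?inE.
Qed.

(** The trace only involves closed walks; extending the sum to all walks adds nonnegative weights.
    The factor [n] counts the starting vertices. *)
Lemma prod_mean_trace_le (sg : R) (k m : nat) : 0 < sg -> (k < m)%N ->
  (forall u, \sum_v \sum_s w (s, [set u; v]) <= sg ^+ 2) ->
  (forall u v, \sum_s w (s, [set u; v]) <= 1) ->
  prod_mean mu (fun z => \tr (mxpow (noise_mx z) k))
    <= n%:R * (3 * sg + 4 * m%:R) ^+ k.
Proof.
move=> sg0 km row cell; rewrite /mxtrace prod_mean_sum.
have -> : n%:R * (3 * sg + 4 * m%:R) ^+ k = \sum_(u < n) (3 * sg + 4 * m%:R) ^+ k.
  by rewrite sumr_const card_ord mulr_natl.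
apply: ler_sum => u _.
apply: le_trans (empty_walk_sum_le w_ge0 sg0 (leq_ltn_trans (leq0n k) km) row cell u km).
have -> : prod_mean mu (fun z => mxpow (noise_mx z) k u u) = prod_mean mu (fun z =>
    \sum_(l <- words V S k | last u [seq y.1 | y <- l] == u)
      \prod_(e <- walk_edges u l) X e (z e)).
  by apply: eq_bigr => z _; rewrite mxpow_walks.
rewrite prod_mean_sum big_mkcond; apply: ler_sum => l _.
by case: ifP => _; [exact: prod_mean_walk|exact: walk_weight_ge0].
Qed.

End TraceMoment.

From mathcomp Require Import all_classical all_reals all_analysis.

Import Order.TTheory GRing.Theory Num.Theory.

Local Open Scope classical_set_scope.
Local Open Scope ring_scope.

(** * Operator norm and trace *)

(** Lagrange's identity: twice the difference of the two sides is a sum of squares. *)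
Lemma cauchy_schwarz (R : realDomainType) (I : finType) (x y : I -> R) :
  (\sum_i x i * y i) ^+ 2 <= (\sum_i x i ^+ 2) * (\sum_i y i ^+ 2).
Proof.
have : 0 <= \sum_i \sum_j (x i * y j - x j * y i) ^+ 2.
  by do 2!apply: sumr_ge0 => ? _; exact: sqr_ge0.
have -> : \sum_i \sum_j (x i * y j - x j * y i) ^+ 2 =
  \sum_i \sum_j (x i ^+ 2 * y j ^+ 2) + \sum_i \sum_j (y i ^+ 2 * x j ^+ 2)
   - (\sum_i \sum_j (x i * y i) * (x j * y j)) *+ 2.
  rewrite -sumrMnl -big_split -sumrB /=; apply: eq_bigr => i _.
  rewrite -sumrMnl -big_split -sumrB /=; apply: eq_bigr => j _; ring.
rewrite -!big_distrlr /= (mulrC (\sum_i y i ^+ 2)) expr2.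
set a := \sum_i _; set b := \sum_i _; set c := \sum_i _; lra.
Qed.

Section OperatorNorm.
Variable R : realType.

Lemma l2norm_ge0 n (x : 'cV[R]_n) : 0 <= l2norm x.
Proof. exact: sqrtr_ge0. Qed.

Lemma sqr_l2norm n (x : 'cV[R]_n) : l2norm x ^+ 2 = \sum_i x i 0 ^+ 2.
Proof. by rewrite sqr_sqrtr // sumr_ge0 // => i _; exact: sqr_ge0. Qed.

Lemma l2norm0 n : l2norm (0 : 'cV[R]_n) = 0.
Proof. by rewrite /l2norm big1 ?sqrtr0 // => i _; rewrite mxE expr0n. Qed.

Lemma l2normZ n (c : R) (x : 'cV[R]_n) : l2norm (c *: x) = `|c| * l2norm x.
Proof.
rewrite /l2norm; under eq_bigr do rewrite mxE exprMn.
by rewrite -mulr_sumr sqrtrM ?sqr_ge0 // sqrtr_sqr.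
Qed.

Lemma dot_l2norm n (x y : 'cV[R]_n) : \sum_i x i 0 * y i 0 <= l2norm x * l2norm y.
Proof.
apply: le_trans (ler_norm _) _.
rewrite -(ler_pXn2r (n := 2)) ?nnegrE ?mulr_ge0 ?l2norm_ge0 //.
by rewrite real_normK ?num_real // exprMn !sqr_l2norm cauchy_schwarz.
Qed.

Lemma l2normD n (x y : 'cV[R]_n) : l2norm (x + y) <= l2norm x + l2norm y.
Proof.
rewrite -(ler_pXn2r (n := 2)) ?nnegrE ?addr_ge0 ?l2norm_ge0 //.
rewrite sqrrD !sqr_l2norm; under eq_bigr do rewrite mxE sqrrD.
by rewrite !big_split /= lerD2r lerD2l mulr2n lerD ?dot_l2norm.
Qed.

(** The Frobenius bound. It makes the supremum in [opnorm22] finite and links the operator norm to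
    the trace in [opnorm22_trace]. *)
Lemma l2norm_mulmx_le m n (M : 'M[R]_(m, n)) (x : 'cV[R]_n) :
  l2norm (M *m x) <= Num.sqrt (\sum_i \sum_j M i j ^+ 2) * l2norm x.
Proof.
rewrite -(ler_pXn2r (n := 2)) ?nnegrE ?mulr_ge0 ?l2norm_ge0 ?sqrtr_ge0 //.
rewrite exprMn !sqr_l2norm sqr_sqrtr; last first.
  by do 2!apply: sumr_ge0 => ? _; exact: sqr_ge0.
rewrite mulr_suml; apply: ler_sum => i _.
by rewrite mxE cauchy_schwarz.
Qed.

Definition image_norms m n (M : 'M[R]_(m, n)) : set R :=
  [set l2norm (M *m x) | x in [set x : 'cV[R]_n | l2norm x <= 1]].

Lemma image_norms_ubound m n (M : 'M[R]_(m, n)) : has_ubound (image_norms M).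
Proof.
exists (Num.sqrt (\sum_i \sum_j M i j ^+ 2)) => _ [x /= x1 <-].
by rewrite (le_trans (l2norm_mulmx_le _ _)) // ler_piMr ?sqrtr_ge0.
Qed.

Lemma image_norms_nonempty m n (M : 'M[R]_(m, n)) : image_norms M !=set0.
Proof. by exists (l2norm (M *m 0)), 0 => //=; rewrite l2norm0. Qed.

Lemma le_opnorm22 m n (M : 'M[R]_(m, n)) (x : 'cV[R]_n) :
  l2norm x <= 1 -> l2norm (M *m x) <= opnorm22 M.
Proof. by move=> x1; apply: (ub_le_sup (image_norms_ubound M)); exists x. Qed.

Lemma opnorm22_le m n (M : 'M[R]_(m, n)) (a : R) :
  (forall x, l2norm x <= 1 -> l2norm (M *m x) <= a) -> opnorm22 M <= a.
Proof.
move=> h; apply: ge_sup (image_norms_nonempty M) _ => _ [x /= x1 <-].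
exact: h.
Qed.

Lemma opnorm22D m n (A B : 'M[R]_(m, n)) :
  opnorm22 (A + B) <= opnorm22 A + opnorm22 B.
Proof.
apply: opnorm22_le => x x1; rewrite mulmxDl (le_trans (l2normD _ _)) //.
by rewrite lerD ?le_opnorm22.
Qed.

Lemma opnorm22_ge0 m n (M : 'M[R]_(m, n)) : 0 <= opnorm22 M.
Proof. by rewrite (le_trans (l2norm_ge0 (M *m 0))) ?le_opnorm22 ?l2norm0. Qed.

Lemma opnorm22Z_le m n (c : R) (M : 'M[R]_(m, n)) :
  opnorm22 (c *: M) <= `|c| * opnorm22 M.
Proof.
apply: opnorm22_le => x x1.
by rewrite -scalemxAl l2normZ ler_wpM2l // le_opnorm22.
Qed.

Lemma opnorm22Z m n (c : R) (M : 'M[R]_(m, n)) :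
  opnorm22 (c *: M) = `|c| * opnorm22 M.
Proof.
apply/eqP; rewrite eq_le opnorm22Z_le /=.
have [->|c0] := eqVneq c 0; first by rewrite normr0 mul0r opnorm22_ge0.
have := opnorm22Z_le c^-1 (c *: M); rewrite scalerA mulVf // scale1r.
by rewrite normfV ler_pdivlMl ?normr_gt0.
Qed.

Lemma opnorm22_gt0 m n (M : 'M[R]_(m, n)) : M != 0 -> 0 < opnorm22 M.
Proof.
move=> M0; rewrite lt_neqAle opnorm22_ge0 andbT eq_sym.
apply: contra M0 => /eqP M0; apply/eqP/matrixP => i j; rewrite mxE.
have dx : l2norm (delta_mx j 0 : 'cV[R]_n) <= 1.
  rewrite /l2norm (bigD1 j) //= big1 ?addr0 => [|k /negbTE kj].
    by rewrite mxE !eqxx expr1n sqrtr1.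
  by rewrite mxE kj expr0n.
have := le_opnorm22 M dx; rewrite M0 => h.
have /eqP : l2norm (M *m (delta_mx j 0 : 'cV[R]_n)) ^+ 2 = 0.
  by apply/eqP; rewrite sqrf_eq0 eq_le h l2norm_ge0.
rewrite sqr_l2norm psumr_eq0 => [/allP/(_ i)|k _]; last exact: sqr_ge0.
rewrite mem_index_enum => /(_ isT); rewrite sqrf_eq0 -colE mxE.
by move/eqP.
Qed.

Lemma opnorm22_distB m n (A B : 'M[R]_(m, n)) :
  opnorm22 A <= opnorm22 (A - B) + opnorm22 B.
Proof. by rewrite -{1}(subrK B A) opnorm22D. Qed.

Lemma opnorm22N m n (A : 'M[R]_(m, n)) : opnorm22 (- A) = opnorm22 A.
Proof. by rewrite -scaleN1r opnorm22Z normrN normr1 mul1r. Qed.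

Lemma mxpowD n (A : 'M[R]_n) j k : mxpow A (j + k) = mxpow A j *m mxpow A k.
Proof. by elim: j => [|j IH]; [rewrite mul1mx|rewrite /= IH mulmxA]. Qed.

Lemma trmx_mxpow n (A : 'M[R]_n) k : A^T = A -> (mxpow A k)^T = mxpow A k.
Proof.
move=> As; elim: k => [|k IH]; first by rewrite trmx1.
have e : mxpow A k.+1 = mxpow A k *m A by rewrite -addn1 mxpowD /= mulmx1.
by rewrite [in LHS]e trmx_mul IH As.
Qed.

Lemma sqr_l2norm_sym n (A : 'M[R]_n) (x : 'cV[R]_n) : A^T = A ->
  l2norm x <= 1 -> l2norm (A *m x) ^+ 2 <= l2norm (A *m A *m x).
Proof.
move=> As x1; rewrite sqr_l2norm.
have -> : \sum_i (A *m x) i 0 ^+ 2 = \sum_i x i 0 * (A *m A *m x) i 0.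
  transitivity (((A *m x)^T *m (A *m x)) 0 0).
    by rewrite mxE; apply: eq_bigr => i _; rewrite [_^T _ _]mxE expr2.
  rewrite trmx_mul As -[x^T *m A *m _]mulmxA mxE; apply: eq_bigr => i _.
  by rewrite [_^T _ _]mxE mulmxA.
by rewrite (le_trans (dot_l2norm _ _)) // ler_piMl ?l2norm_ge0.
Qed.

(** Repeated squaring through [sqr_l2norm_sym] takes the place of the spectral theorem; this is why
    the moment orders are powers of two. *)
Lemma l2norm_pow_le n (A : 'M[R]_n) (x : 'cV[R]_n) j : A^T = A ->
  l2norm x <= 1 -> l2norm (A *m x) ^+ (2 ^ j) <= l2norm (mxpow A (2 ^ j) *m x).
Proof.
move=> As x1; elim: j => [|j IH]; first by rewrite expr1 /= mulmx1.
rewrite expnSr exprM muln2 -addnn mxpowD.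
apply: le_trans (sqr_l2norm_sym (trmx_mxpow _ As) x1).
by rewrite ler_pXn2r ?nnegrE ?exprn_ge0 ?l2norm_ge0.
Qed.

(** For symmetric [A], the trace of an even power is the squared Frobenius norm of the power of half
    the order. *)
Lemma opnorm22_trace n (A : 'M[R]_n) j (a : R) : A^T = A -> 0 <= a ->
  \tr (mxpow A (2 ^ j.+1)) <= a ^+ (2 ^ j.+1) -> opnorm22 A <= a.
Proof.
move=> As a0 tra; apply: opnorm22_le => x x1.
rewrite -(ler_pXn2r (n := 2 ^ j.+1)) ?expn_gt0 ?nnegrE ?l2norm_ge0 //.
apply: le_trans tra; rewrite expnSr exprM.
have -> : \tr (mxpow A (2 ^ j * 2)) = \sum_i \sum_k mxpow A (2 ^ j) i k ^+ 2.
  rewrite muln2 -addnn mxpowD -{1}(trmx_mxpow _ As) mxtrace_mulC.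
  apply: eq_bigr => i _; rewrite mxE; apply: eq_bigr => k _.
  by rewrite mxE expr2.
rewrite -[leRHS]sqr_sqrtr; last by do 2!apply: sumr_ge0 => ? _; exact: sqr_ge0.
rewrite ler_pXn2r ?nnegrE ?exprn_ge0 ?l2norm_ge0 ?sqrtr_ge0 //.
rewrite (le_trans (l2norm_pow_le _ As x1)) // (le_trans (l2norm_mulmx_le _ _)) //.
by rewrite ler_piMr ?sqrtr_ge0.
Qed.

End OperatorNorm.

(** * The CUSUM signal *)

Section Cusum.
Variable R : realType.

(** The statistic is a single weighted sum of the observations; for [0 < t < T] its weights sum to
    zero and their squares sum to 1. *)
Definition cusum_coef (T t s : nat) : R :=
  Num.sqrt (t%:R * (T%:R - t%:R) / T%:R) *
    (if (s <= t)%N then t%:R^-1 else - (T%:R - t%:R)^-1).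

Lemma cusum_coefE n T (Y : nat -> 'M[R]_n) t : (t <= T)%N ->
  cusum T Y t = \sum_(1 <= s < T.+1) cusum_coef T t s *: Y s.
Proof.
move=> tT; rewrite (big_cat_nat (n := t.+1)) //= /cusum scalerBr.
congr (_ + _).
  rewrite !scaler_sumr; apply: eq_big_nat => s /andP[_ st].
  by rewrite /cusum_coef -ltnS st scalerA.
rewrite -scalerN -scaleNr !scaler_sumr; apply: eq_big_nat => s /andP[ts _].
by rewrite /cusum_coef leqNgt ts scalerA.
Qed.

Lemma sum_nat_split (a b : R) (T t : nat) : (t <= T)%N ->
  \sum_(1 <= s < T.+1) (if (s <= t)%N then a else b) = t%:R * a + (T%:R - t%:R) * b.
Proof.
move=> tT; rewrite (big_cat_nat (n := t.+1)) //=; congr (_ + _).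
  rewrite (eq_big_nat _ _ (F2 := fun=> a)) => [|s /andP[_ st]]; last by rewrite -ltnS st.
  by rewrite sumr_const_nat subSS subn0 mulr_natl.
rewrite (eq_big_nat _ _ (F2 := fun=> b)) => [|s /andP[st _]]; last by rewrite leqNgt st.
by rewrite sumr_const_nat subSS -[LHS]mulr_natl natrB.
Qed.

Lemma sum_nat_split_tail (a b : R) (T t u : nat) : (t <= T)%N -> (u <= T)%N ->
  \sum_(1 <= s < T.+1) (if (s <= t)%N then a else b) * (u < s)%:R =
    if (u <= t)%N then (t%:R - u%:R) * a + (T%:R - t%:R) * b
    else (T%:R - u%:R) * b.
Proof.
move=> tT uT.
have -> : \sum_(1 <= s < T.+1) (if (s <= t)%N then a else b) * (u < s)%:R
  = \sum_(u.+1 <= s < T.+1) (if (s <= t)%N then a else b).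
  rewrite (big_cat_nat (n := u.+1)) //= big_nat big1 => [|s /andP[_ su]]; last first.
    by rewrite (ltnNge u) (su : (s <= u)%N) mulr0.
  by rewrite add0r; apply: eq_big_nat => s /andP[us _]; rewrite us mulr1.
have e : \sum_(1 <= s < u.+1) (if (s <= t)%N then a else b) +
   \sum_(u.+1 <= s < T.+1) (if (s <= t)%N then a else b) =
   t%:R * a + (T%:R - t%:R) * b.
  by rewrite -big_cat_nat // sum_nat_split.
move: e => /(canRL (addKr _)) ->.
have [ut|tu] := leqP u t; last by rewrite sum_nat_split ?(ltnW tu) //; ring.
rewrite (eq_big_nat _ _ (F2 := fun=> a)) => [|s /andP[_ st]]; last first.
  by rewrite (leq_trans _ ut) // -ltnS.
by rewrite sumr_const_nat subSS subn0 -[in LHS]mulr_natl; ring.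
Qed.

Lemma sum_cusum_coef T t : (0 < t < T)%N ->
  \sum_(1 <= s < T.+1) cusum_coef T t s = 0.
Proof.
move=> /andP[t0 tT]; rewrite -mulr_sumr sum_nat_split ?(ltnW tT) //.
by rewrite mulrN !mulfV ?subrr ?mulr0 // ?subr_eq0 ?eqr_nat ?pnatr_eq0; lia.
Qed.

Lemma sum_sqr_cusum_coef T t : (0 < t < T)%N ->
  \sum_(1 <= s < T.+1) cusum_coef T t s ^+ 2 = 1.
Proof.
move=> /andP[t0 tT].
have t0R : 0 < t%:R :> R by rewrite ltr0n.
have tTR : t%:R < T%:R :> R by rewrite ltr_nat.
under eq_bigr => s _.
  rewrite /cusum_coef exprMn sqr_sqrtr; last first.
    by rewrite divr_ge0 ?mulr_ge0 ?subr_ge0 // ltW.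
  rewrite (_ : (if _ then _ else _) ^+ 2 =
    if (s <= t)%N then t%:R^-1 ^+ 2 else (T%:R - t%:R)^-1 ^+ 2); last first.
    by case: ifP; rewrite ?sqrrN.
  over.
rewrite -mulr_sumr sum_nat_split ?(ltnW tT) //.
by field; rewrite !gt_eqF ?subr_gt0 // (lt_trans t0R).
Qed.

Lemma cusum_coef_sqr_le1 T t s : (0 < t < T)%N -> (0 < s <= T)%N ->
  cusum_coef T t s ^+ 2 <= 1.
Proof.
move=> tT sT; rewrite -(sum_sqr_cusum_coef tT).
rewrite (big_cat_nat (n := s)) /=; [|lia|lia].
rewrite [X in _ <= _ + X]big_nat_recl; last by lia.
rewrite addrCA lerDl addr_ge0 // sumr_ge0 // => *; exact: sqr_ge0.
Qed.

(** Up to sign, the coefficient of the jump in the noiseless statistic. *)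
Definition cusum_signal (T tau t : nat) : R :=
  Num.sqrt (t%:R * (T%:R - t%:R) / T%:R) *
    (if (tau <= t)%N then tau%:R / t%:R else (T%:R - tau%:R) / (T%:R - t%:R)).

(** The common part [M] disappears because the weights sum to zero; what remains is the total weight
    of the times after [tau]. *)
Lemma cusum_change n T tau (Y : nat -> 'M[R]_n) (M D : 'M[R]_n) t :
  (0 < t < T)%N -> (tau <= T)%N ->
  (forall s, (1 <= s <= tau)%N -> Y s = M) ->
  (forall s, (tau < s <= T)%N -> Y s = M + D) ->
  cusum T Y t = - cusum_signal T tau t *: D.
Proof.
move=> /andP[t0 tT] tauT Y1 Y2; rewrite cusum_coefE ?(ltnW tT) //.
transitivity (\sum_(1 <= s < T.+1)
    (cusum_coef T t s *: M + (cusum_coef T t s * (tau < s)%:R) *: D)).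
  apply: eq_big_nat => s /andP[s1 sT]; rewrite ltnS in sT.
  have [taus|staus] := ltnP tau s; first by rewrite Y2 ?taus // scalerDr mulr1.
  by rewrite Y1 ?s1 // mulr0 scale0r addr0.
rewrite big_split /= -scaler_suml sum_cusum_coef ?t0 // scale0r add0r -scaler_suml.
congr (_ *: _); rewrite /cusum_coef /cusum_signal.
under eq_bigr => s _ do rewrite -[_ * (tau < s)%:R]mulrA.
rewrite -mulr_sumr sum_nat_split_tail ?(ltnW tT) // -mulrN; congr (_ * _).
have t0R : t%:R != 0 :> R by rewrite pnatr_eq0; lia.
have tTR : T%:R - t%:R != 0 :> R by rewrite subr_eq0 eqr_nat; lia.
by case: ifP => _; field; rewrite ?t0R ?tTR.
Qed.

Lemma qfun_ge0 (x : R) : 0 <= qfun x.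
Proof. exact: sqrtr_ge0. Qed.

Lemma qfun_gap_left (x y : R) : 0 < x -> x <= y -> y < 1 ->
  qfun y * (y - x) <= qfun y - qfun x * ((1 - y) / (1 - x)).
Proof.
move=> x0 xy y1.
suff : qfun x * ((1 - y) / (1 - x)) <= qfun y * (1 - (y - x)) by lra.
have x1 : 0 < 1 - x by lra.
rewrite -(ler_pXn2r (n := 2)) ?nnegrE //; last 2 first.
- by rewrite !mulr_ge0 ?qfun_ge0 ?invr_ge0 //; lra.
- by rewrite mulr_ge0 ?qfun_ge0 //; lra.
rewrite !exprMn !sqr_sqrtr; [|by rewrite mulr_ge0 //; lra..].
rewrite exprVn -subr_ge0.
have -> : y * (1 - y) * (1 - (y - x)) ^+ 2 - x * (1 - x) * ((1 - y) ^+ 2 / (1 - x) ^+ 2)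
  = (1 - y) / (1 - x) * (y * (1 - x) * (1 - (y - x)) ^+ 2 - x * (1 - y)).
  by field; lra.
apply: mulr_ge0; first by apply: divr_ge0; lra.
(* Substituting [y (1 - x) = (y - x) + x (1 - y)] brings out the factor [y - x]. *)
have -> : y * (1 - x) * (1 - (y - x)) ^+ 2 - x * (1 - y) =
  (y - x) * ((1 - (y - x)) ^+ 2 - x * (1 - y) * (2 - (y - x))) by ring.
rewrite mulr_ge0 ?subr_ge0 //.
(* AM-GM for [x] and [1 - y], whose sum is [1 - (y - x)]. *)
have h : x * (1 - y) <= (1 - (y - x)) ^+ 2 / 4.
  have : 0 <= (x - (1 - y)) ^+ 2 by exact: sqr_ge0.
  lra.
apply: (@le_trans _ _ ((1 - (y - x)) ^+ 2 / 4 * (2 - (y - x)))); last first.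
  have : 0 <= (1 - (y - x)) ^+ 2 by exact: sqr_ge0.
  nra.
by rewrite ler_wpM2r //; lra.
Qed.

Lemma qfunC (x : R) : qfun (1 - x) = qfun x.
Proof. by rewrite /qfun subKr mulrC. Qed.

(** The left case reflected by [x -> 1 - x], which preserves [qfun]. *)
Lemma qfun_gap_right (x y : R) : 0 < y -> y <= x -> x < 1 ->
  qfun y * (x - y) <= qfun y - qfun x * (y / x).
Proof.
move=> y0 yx x1; have := @qfun_gap_left (1 - x) (1 - y).
rewrite !qfunC !subKr => /(_ _ _ _).
by rewrite (_ : 1 - y - (1 - x) = x - y); [apply; lra|ring].
Qed.

Lemma cusum_signalE T tau t : (0 < t < T)%N -> (0 < tau < T)%N ->
  cusum_signal T tau t = Num.sqrt T%:R * (qfun (t%:R / T%:R) *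
    (if (tau <= t)%N then (tau%:R / T%:R) / (t%:R / T%:R)
     else (1 - tau%:R / T%:R) / (1 - t%:R / T%:R))).
Proof.
move=> tT tauT; rewrite mulrA /cusum_signal /qfun -sqrtrM ?ler0n //.
have T0 : T%:R != 0 :> R by rewrite pnatr_eq0; lia.
have t0 : t%:R != 0 :> R by rewrite pnatr_eq0; lia.
have tT0 : T%:R - t%:R != 0 :> R by rewrite subr_eq0 eqr_nat; lia.
congr (Num.sqrt _ * _); first by field.
by case: ifP => _; field; rewrite ?T0 ?t0 ?tT0.
Qed.

Lemma cusum_signal_gap T tau t : (0 < t < T)%N -> (0 < tau < T)%N ->
  Num.sqrt T%:R * qfun (tau%:R / T%:R) * `|t%:R / T%:R - tau%:R / T%:R|
  <= cusum_signal T tau tau - cusum_signal T tau t.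
Proof.
move=> tT tauT; rewrite !cusum_signalE // leqnn -mulrBr -mulrA ler_wpM2l ?sqrtr_ge0 //.
have T0 : 0 < T%:R :> R by rewrite ltr0n; lia.
have ratio_itv (s : nat) : (0 < s < T)%N -> 0 < s%:R / T%:R :> R /\ s%:R / T%:R < 1 :> R.
  by move=> /andP[s0 sT]; split; [rewrite divr_gt0 // ltr0n|rewrite ltr_pdivrMr // mul1r ltr_nat].
have [[t0 t1] [tau0 tau1]] := (ratio_itv _ tT, ratio_itv _ tauT).
rewrite divff ?gt_eqF // mulr1; case: (leqP tau t) => tt.
  have le : tau%:R / T%:R <= t%:R / T%:R :> R by rewrite ler_pM2r ?invr_gt0 // ler_nat.
  by rewrite ger0_norm ?subr_ge0 // qfun_gap_right.
have le : t%:R / T%:R <= tau%:R / T%:R :> R by rewrite ler_pM2r ?invr_gt0 // ler_nat ltnW.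
by rewrite distrC ger0_norm ?subr_ge0 // qfun_gap_left.
Qed.

(** At [tau] the statistic is at least its signal minus [eta], at [t] at most its signal plus [eta],
    and [t] is a maximiser; so the two signals differ by at most [2 * eta]. *)
Lemma cusum_argmax_bound n T tau t (Y M : nat -> 'M[R]_n) (M0 D : 'M[R]_n) (eta : R) :
  (0 < tau < T)%N ->
  (forall s, (1 <= s <= tau)%N -> M s = M0) ->
  (forall s, (tau < s <= T)%N -> M s = M0 + D) ->
  (forall s, (0 < s < T)%N -> opnorm22 (cusum T Y s - cusum T M s) <= eta) ->
  cusum_argmax T Y t ->
  Num.sqrt T%:R * qfun (tau%:R / T%:R) * `|t%:R / T%:R - tau%:R / T%:R| * opnorm22 D
  <= 2 * eta.
Proof.
move=> tauT M1 M2 noise [tT /(_ _ tauT) tmax].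
have tauT' : (tau <= T)%N by lia.
have signal (s : nat) : (0 < s < T)%N ->
    opnorm22 (cusum T M s) = cusum_signal T tau s * opnorm22 D.
  move=> sT; rewrite (cusum_change sT tauT' M1 M2) opnorm22Z normrN ger0_norm //.
  rewrite mulr_ge0 ?sqrtr_ge0 //; case: ifP => _; first by rewrite divr_ge0.
  by rewrite divr_ge0 // subr_ge0 ler_nat; lia.
apply: (@le_trans _ _ ((cusum_signal T tau tau - cusum_signal T tau t) * opnorm22 D)).
  by rewrite ler_wpM2r ?opnorm22_ge0 // cusum_signal_gap.
rewrite mulrBl -!signal //.
have h1 := opnorm22_distB (cusum T M tau) (cusum T Y tau).
rewrite -(opnorm22N (cusum T M tau - cusum T Y tau)) opprB in h1.
have h2 := opnorm22_distB (cusum T Y t) (cusum T M t).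
have := noise _ tauT; have := noise _ tT; move: h1 h2 tmax.
move: (opnorm22 (cusum T M tau)) (opnorm22 (cusum T M t)) => a b.
move: (opnorm22 (cusum T Y tau)) (opnorm22 (cusum T Y t)) => c e.
move: (opnorm22 _) (opnorm22 _) => f g; lra.
Qed.

End Cusum.

(** * The law of the links *)

Section EdgeCoding.
Variables (n T : nat).
Local Notation D := ('I_T * 'I_n * 'I_n)%type.
Local Notation E := ('I_T * {set 'I_n})%type.

(* Walks use unordered pairs of vertices whereas the data is indexed by i < j.
   The labelled sets that are not a pair are given the constant outcome
   [(false, false)] and no noise. *)
Definition ordered_pair (x : D) : bool := (x.1.2 < x.2)%N.
Definition edge_of (x : D) : E := (x.1.1, [set x.1.2; x.2]%SET).
Definition unedge (e : E) : option D := [pick x | ordered_pair x && (e == edge_of x)].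

Lemma edge_of_inj x y :
  ordered_pair x -> ordered_pair y -> edge_of x = edge_of y -> x = y.
Proof.
case: x y => [[s i] j] [[s' i'] j']; rewrite /ordered_pair /edge_of /=.
move=> ij ij' [-> /setP ee].
have := ee i; rewrite !inE eqxx /= => /esym/orP ii.
have := ee j; rewrite !inE eqxx orbT /= => /esym/orP jj.
move: ij ij'; case: ii => /eqP ->; case: jj => /eqP -> //; lia.
Qed.

Lemma unedge_edge x : ordered_pair x -> unedge (edge_of x) = Some x.
Proof.
move=> xo; rewrite /unedge; case: pickP => [y /andP[yo /eqP /esym xy]|/(_ x)].
  by rewrite (edge_of_inj yo xo xy).
by rewrite xo eqxx.
Qed.

Lemma unedge_some e x : unedge e = Some x -> ordered_pair x /\ e = edge_of x.
Proof. by rewrite /unedge; case: pickP => // y /andP[? /eqP ?] [<-]. Qed.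

Lemma unedge_loop s i : unedge (s, [set i; i]%SET) = None.
Proof.
rewrite /unedge; case: pickP => // -[[s' j] k] /andP[jk /eqP[_ /setP ee]].
have := ee j; have := ee k; rewrite !inE !eqxx orbT /= !orbb => /eqP ki /eqP ji.
by move: jk; rewrite /ordered_pair /= ki ji ltnn.
Qed.

Lemma prod_edges (R : comNzRingType) (F : E -> R) :
  (forall e, unedge e = None -> F e = 1) ->
  \prod_e F e = \prod_(x <- enum ordered_pair) F (edge_of x).
Proof.
move=> F1; rewrite big_enum /=.
rewrite (bigID (fun e => isSome (unedge e))) /= [X in _ * X]big1 ?mulr1; last first.
  by move=> e; case ue : (unedge e) => // _; exact: F1.
rewrite -[RHS](big_imset (h := edge_of) F) /=; last first.
  by move=> x y; rewrite !unfold_in; exact: edge_of_inj.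
apply: eq_bigl => e; apply/idP/imsetP => [|[x xo ->]]; last by rewrite unedge_edge.
by case ue : (unedge e) => [x|//] _; have [xo ->] := unedge_some ue; exists x.
Qed.

End EdgeCoding.

Section FiniteLaw.
Context (R : realType) (d : measure_display) (W : measurableType d).
Context (P : probability W R) (n T : nat) (Pi : 'M[R]_n) (Theta : nat -> 'M[R]_n).
Context (A Om : nat -> 'I_n -> 'I_n -> {RV P >-> bool}) (Y : nat -> W -> 'M[R]_n).
Hypothesis params : network_parameters T Pi Theta.
Hypothesis data : missing_links_data T Pi Theta A Om Y.
Local Notation D := ('I_T * 'I_n * 'I_n)%type.
Local Notation E := ('I_T * {set 'I_n})%type.

Definition bernoulli_mass (p : R) (b : bool) : R := if b then p else 1 - p.

(** Each outcome is a pair link, mask. The ordinal [s] stands for the time [s.+1], as times start at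
    1. *)
Definition link_outcome (w : W) (e : E) : bool * bool :=
  if unedge e is Some (s, i, j) then (A s.+1 i j w, Om s.+1 i j w) else (false, false).

Definition link_mass (e : E) (b : bool * bool) : R :=
  if unedge e is Some (s, i, j)
  then bernoulli_mass (Theta s.+1 i j) b.1 * bernoulli_mass (Pi i j) b.2
  else (b == (false, false))%:R.

Lemma bernoulli_mass_prob (X : {RV P >-> bool}) (p : R) b : 0 <= p <= 1 ->
  distribution P X =1 bernoulli_prob p -> P (X @^-1` [set b]) = (bernoulli_mass p b)%:E.
Proof.
move=> p01 /(_ [set b]); rewrite /distribution /pushforward => ->.
rewrite bernoulli_probE // !diracE /bernoulli_mass /unstable.onem.
case: b; rewrite (mem_set (erefl _ : [set _] _)).
  rewrite memNset /=; last by [].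
  by rewrite mule0 adde0 mule1.
rewrite memNset /=; last by [].
by rewrite mule0 add0e mule1.
Qed.

Lemma time_itv (s : 'I_T) : (1 <= s.+1 <= T)%N.
Proof. exact: ltn_ord. Qed.

Definition outcome_fun (w : W) : {ffun E -> bool * bool} := [ffun e => link_outcome w e].

Lemma Pi_itv i j : 0 <= Pi i j <= 1.
Proof. by rewrite (ltW (Pi_gt0 params i j)) (Pi_le1 params). Qed.

(** Fixing the outcome amounts to fixing every link and every mask with [i < j], a finite
    intersection to which the independence hypothesis applies. *)
Lemma outcome_law (z : {ffun E -> bool * bool}) :
  measurable [set w | outcome_fun w = z] /\
  P [set w | outcome_fun w = z] = (prod_weight link_mass z)%:E.
Proof.
(* If [z] is not the constant outcome at a labelled set that is not a pair, the event is empty and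
   the mass is zero. *)
have [[e [ue ze]]|nz] := pselect (exists e, unedge e = None /\ z e <> (false, false)).
  have -> : [set w | outcome_fun w = z] = set0.
    apply/seteqP; split => // w /= zw; apply: ze.
    by rewrite -zw ffunE /link_outcome ue.
  split; first exact: measurable0.
  rewrite measure0 /prod_weight (bigD1 e) //= /link_mass ue.
  by move/eqP/negbTE: ze => ->; rewrite mul0r.
have z0 e : unedge e = None -> z e = (false, false).
  by move=> ue; apply: contrapT => h; apply: nz; exists e.
pose key (x : D) := (nat_of_ord x.1.1).+1.
pose k3 (x : D) : nat * 'I_n * 'I_n := (key x, x.1.2, x.2).
have k3_inj : injective k3.
  by move=> [[s i] j] [[s' i'] j'] [] /val_inj -> -> ->.
pose r : seq D := enum (@ordered_pair n T).
pose J := [seq inl (k3 x) | x <- r] ++ [seq inr (k3 x) | x <- r].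
(* Independence asks for a set at every index: this one is the singleton prescribed by [z] at the
   indices in [J] and the whole of [bool] elsewhere. *)
pose B (k : nat * 'I_n * 'I_n + nat * 'I_n * 'I_n) : set bool :=
  match k with
  | inl t => [set b | forall x, ordered_pair x -> k3 x = t -> b = (z (edge_of x)).1]
  | inr t => [set b | forall x, ordered_pair x -> k3 x = t -> b = (z (edge_of x)).2]
  end.
have Bl x : ordered_pair x -> B (inl (k3 x)) = [set (z (edge_of x)).1].
  move=> xo; apply/seteqP; split => b /=; first exact.
  by move=> -> y _ /k3_inj ->.
have Br x : ordered_pair x -> B (inr (k3 x)) = [set (z (edge_of x)).2].
  move=> xo; apply/seteqP; split => b /=; first exact.
  by move=> -> y _ /k3_inj ->.
have Juniq : uniq J.
  rewrite cat_uniq !map_inj_uniq ?enum_uniq /= ?andbT; last 2 first.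
  - by apply: (inj_comp _ k3_inj) => a b [].
  - by apply: (inj_comp _ k3_inj) => a b [].
  by apply/hasPn => _ /mapP[x _ ->]; apply/negP => /mapP[].
have JD k : k \in J -> joint_index T k.
  by rewrite mem_cat => /orP[] /mapP[x]; rewrite mem_enum => xo -> /=;
    split => //; exact: time_itv.
have eqJ : [set w | outcome_fun w = z] =
    \bigcap_(k in [set k | k \in J]) (joint_family A Om k @^-1` B k).
  apply/seteqP; split => w /=.
    move=> zw k /=; rewrite mem_cat => /orP[] /mapP[[[s i] j]]; rewrite mem_enum => xo ->.
      by rewrite Bl // /preimage /= -zw ffunE /link_outcome unedge_edge.
    by rewrite Br // /preimage /= -zw ffunE /link_outcome unedge_edge.
  move=> h; apply/ffunP => e; rewrite ffunE /link_outcome.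
  case ue : (unedge e) => [[[s i] j]|]; last by rewrite z0.
  have [xo ->] := unedge_some ue.
  have xr : (s, i, j) \in r by rewrite mem_enum.
  have hl : inl (k3 (s, i, j)) \in J by rewrite mem_cat map_f.
  have hr : inr (k3 (s, i, j)) \in J by rewrite mem_cat orbC map_f.
  have := h _ hl; have := h _ hr; rewrite Bl // Br // /preimage /= => -> ->.
  by case: (z _).
split.
  rewrite eqJ; apply: fin_bigcap_measurable; first exact: finite_seq.
  by move=> k _; rewrite -[X in measurable X]setTI; exact: measurable_funP.
rewrite eqJ (link_mask_indep data Juniq JD (fun k _ => _ : measurable (B k))) //.
rewrite big_cat !big_map /prod_weight prod_edges; last first.
  by move=> e ue; rewrite /link_mass ue z0.
have -> : (\prod_(x <- r) P (joint_family A Om (inl (k3 x)) @^-1` B (inl (k3 x))) =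
  \prod_(x <- r) (bernoulli_mass (Theta (key x) x.1.2 x.2) (z (edge_of x)).1)%:E)%E.
  apply: eq_big_seq => -[[s i] j]; rewrite mem_enum => xo; rewrite Bl //.
  apply: bernoulli_mass_prob; first exact: Theta_itv params _ (time_itv s) _ _.
  exact: link_law data _ _ _ (time_itv s) xo.
have -> : (\prod_(x <- r) P (joint_family A Om (inr (k3 x)) @^-1` B (inr (k3 x))) =
  \prod_(x <- r) (bernoulli_mass (Pi x.1.2 x.2) (z (edge_of x)).2)%:E)%E.
  apply: eq_big_seq => -[[s i] j]; rewrite mem_enum => xo; rewrite Br //.
  apply: bernoulli_mass_prob; first exact: Pi_itv.
  exact: mask_law data _ _ _ (time_itv s) xo.
rewrite !prodEFin /= -EFinM -big_split /=; congr (_%:E); apply: eq_big_seq => -[[s i] j].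
by rewrite mem_enum => xo; rewrite /link_mass unedge_edge.
Qed.

Lemma outcome_prob (S : pred {ffun E -> bool * bool}) :
  measurable [set w | S (outcome_fun w)] /\
  P [set w | S (outcome_fun w)] = (\sum_(z | S z) prod_weight link_mass z)%:E.
Proof.
have eqS : [set w | S (outcome_fun w)] =
  \bigcup_(z in [set` enum S]) [set w | outcome_fun w = z].
  apply/seteqP; split => w /=.
    by move=> Sw; exists (outcome_fun w) => //=; rewrite mem_enum.
  by move=> [z /=]; rewrite mem_enum => Sz ->.
split.
  rewrite eqS; apply: fin_bigcup_measurable => [|z _]; first exact: finite_seq.
  by case: (outcome_law z).
rewrite eqS measure_fin_bigcup; last 3 first.
- exact: finite_seq.
- by move=> z z' _ _ [w [/= -> ->]].
- by move=> z _; case: (outcome_law z).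
rewrite -fsbig_seq ?enum_uniq // big_enum /= -sumEFin.
by apply: eq_bigr => z _; case: (outcome_law z).
Qed.

End FiniteLaw.

Lemma sum_outcomes (R : nmodType) (F : bool * bool -> R) :
  \sum_b F b = F (true, true) + F (true, false) + (F (false, true) + F (false, false)).
Proof.
rewrite (eq_bigr (fun b => F (b.1, b.2))) => [|[]//].
by rewrite -(pair_bigA _ (fun a b => F (a, b))) /= !big_bool.
Qed.

(** * Tail bound for the noise *)

Section Noise.
Context (R : realType) (n T : nat) (Pi : 'M[R]_n) (Theta : nat -> 'M[R]_n).
Hypothesis params : network_parameters T Pi Theta.
Local Notation E := ('I_T * {set 'I_n})%type.

Local Notation mean s := (hadamard Pi (Theta s)).

Definition link_noise (t : nat) (e : E) (b : bool * bool) : R :=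
  if unedge e is Some (s, i, j)
  then cusum_coef R T t s.+1 * (b.2%:R * b.1%:R - mean s.+1 i j) else 0.

(** Bounds the variance [c^2 p (1 - p)] by [c^2 p], which is linear in the mean [p], so that row
    sums are controlled by [norm1inf]. *)
Definition link_weight (t : nat) (e : E) : R :=
  if unedge e is Some (s, i, j)
  then cusum_coef R T t s.+1 ^+ 2 * mean s.+1 i j else 0.

Let Theta01 (s : 'I_T) i j : 0 <= Theta s.+1 i j <= 1.
Proof. exact: Theta_itv params _ (time_itv s) _ _. Qed.

Lemma mean_itv (s : 'I_T) i j : 0 <= mean s.+1 i j <= 1.
Proof.
have /andP[p0 p1] := Pi_itv params i j; have /andP[t0 t1] := Theta01 s i j.
by rewrite mxE mulr_ge0 // mulr_ile1.
Qed.

Lemma mean_sym (s : 'I_T) i j : mean s.+1 i j = mean s.+1 j i.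
Proof. by rewrite !mxE (Pi_sym params) (Defs.Theta_sym params (time_itv s)). Qed.

Lemma mean_diag (s : 'I_T) i : mean s.+1 i i = 0.
Proof. by rewrite mxE (Theta_diag params (time_itv s)) mulr0. Qed.

Lemma link_mass1 (e : E) : \sum_b link_mass Pi Theta e b = 1.
Proof.
rewrite sum_outcomes /link_mass; case: unedge => [[[s i] j]|] /=; last by rewrite !add0r.
ring.
Qed.

Lemma link_mass_ge0 (e : E) b : 0 <= link_mass Pi Theta e b.
Proof.
rewrite /link_mass; case: unedge => [[[s i] j]|] //.
have /andP[p0 p1] := Pi_itv params i j; have /andP[t0 t1] := Theta01 s i j.
by case: b => [[] []] /=; rewrite mulr_ge0 ?subr_ge0.
Qed.

Lemma link_moment t (e : E) k : \sum_b link_mass Pi Theta e b * link_noise t e b ^+ k.+1 =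
  if unedge e is Some (s, i, j) then
    cusum_coef R T t s.+1 ^+ k.+1 *
      (mean s.+1 i j * (1 - mean s.+1 i j) ^+ k.+1 +
       (1 - mean s.+1 i j) * (- mean s.+1 i j) ^+ k.+1)
  else 0.
Proof.
rewrite sum_outcomes /link_mass /link_noise; case: unedge => [[[s i] j]|] /=; last first.
  by rewrite !expr0n /= !mulr0 !addr0.
rewrite !(mul0r, mul1r, mulr0) !mulr0n !sub0r !exprMn mxE.
set c := _ ^+ k.+1; set x := (1 - _) ^+ k.+1; set y := (- _) ^+ k.+1; ring.
Qed.

Lemma link_mean0 t (e : E) : \sum_b link_mass Pi Theta e b * link_noise t e b = 0.
Proof.
under eq_bigr do rewrite -[link_noise _ _ _]expr1.
rewrite link_moment; case: unedge => [[[s i] j]|] //; ring.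
Qed.

(** Both the coefficient and the centred Bernoulli variable have modulus at most 1, so a moment of
    order at least 2 does not exceed the variance. *)
Lemma link_moment_le t (e : E) k : (0 < t < T)%N ->
  `|\sum_b link_mass Pi Theta e b * link_noise t e b ^+ k.+2| <= link_weight t e.
Proof.
move=> tT; rewrite link_moment /link_weight.
case: unedge => [[[s i] j]|]; last by rewrite normr0.
have /andP[p0 p1] := mean_itv s i j; set p := mean _ _ _ in p0 p1 *.
set c := cusum_coef _ _ _ _.
have c1 : `|c| <= 1.
  rewrite -(ler_pXn2r (n := 2)) ?nnegrE // real_normK ?num_real // expr1n.
  by rewrite cusum_coef_sqr_le1 // time_itv.
rewrite normrM normrX -[c ^+ 2](real_normK (num_real c)); apply: ler_pM => //.
  by rewrite ler_wiXn2l.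
apply: le_trans (ler_normD _ _) _; rewrite (normrM p) normrX (normrM (1 - p)) normrX normrN.
rewrite !ger0_norm ?subr_ge0 //.
have q0 : 0 <= 1 - p by lra.
have h1 : (1 - p) ^+ k.+2 <= (1 - p) ^+ 2 by rewrite ler_wiXn2l //; lra.
have h2 : p ^+ k.+2 <= p ^+ 2 by rewrite ler_wiXn2l.
apply: (@le_trans _ _ (p * (1 - p) ^+ 2 + (1 - p) * p ^+ 2)).
  by rewrite lerD // ler_wpM2l.
by nra.
Qed.

Lemma link_weightE t (s : 'I_T) u v :
  link_weight t (s, [set u; v]%SET) = cusum_coef R T t s.+1 ^+ 2 * mean s.+1 u v.
Proof.
have lt_case (x y : 'I_n) : (x < y)%N ->
    link_weight t (s, [set x; y]%SET) = cusum_coef R T t s.+1 ^+ 2 * mean s.+1 x y.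
  by move=> xy; rewrite /link_weight (@unedge_edge _ _ (s, x, y)).
have [uv|vu|uv] := ltngtP u v; first exact: lt_case.
  by rewrite finset.setUC mean_sym lt_case.
by rewrite (val_inj uv) /link_weight unedge_loop mean_diag mulr0.
Qed.

Lemma link_weight_loop t (s : 'I_T) u : link_weight t (s, [set u; u]%SET) = 0.
Proof. by rewrite link_weightE mean_diag mulr0. Qed.

Lemma sum_ord_cusum_coef_sqr t : (0 < t < T)%N ->
  \sum_(s < T) cusum_coef R T t s.+1 ^+ 2 = 1.
Proof.
move=> tT; rewrite -(sum_sqr_cusum_coef R tT) big_add1 big_mkord //.
Qed.

Lemma link_weight_cell t u v : (0 < t < T)%N ->
  \sum_s link_weight t (s, [set u; v]%SET) <= 1.
Proof.
move=> tT; rewrite -(sum_ord_cusum_coef_sqr tT); apply: ler_sum => s _.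
by rewrite link_weightE ler_piMr ?sqr_ge0 //; case/andP: (mean_itv s u v).
Qed.

(** The squared coefficients sum to 1, so this is an average over the times of row sums of the
    means; by symmetry these are the column sums in [norm1inf]. *)
Lemma link_weight_row t u omega : (0 < t < T)%N ->
  (forall s, (1 <= s <= T)%N -> norm1inf (mean s) <= omega) ->
  \sum_v \sum_s link_weight t (s, [set u; v]%SET) <= omega.
Proof.
move=> tT hom; rewrite exchange_big /= -[leRHS]mul1r -(sum_ord_cusum_coef_sqr tT) mulr_suml.
apply: ler_sum => s _; under eq_bigr do rewrite link_weightE.
rewrite -mulr_sumr ler_wpM2l ?sqr_ge0 //; apply: le_trans (hom _ (time_itv s)).
apply: le_trans (le_bigmax _ _ u) => /=; apply: ler_sum => v _.
by rewrite mean_sym ler_norm.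
Qed.

Lemma noise_mx_sym t z : (noise_mx (link_noise t) z)^T = noise_mx (link_noise t) z.
Proof.
by apply/matrixP => u v; rewrite !mxE; apply: eq_bigr => s _; rewrite finset.setUC.
Qed.

Lemma trace_even_ge0 (M : 'M[R]_n) j : M^T = M -> 0 <= \tr (mxpow M (2 ^ j.+1)).
Proof.
move=> Ms; rewrite expnSr muln2 -addnn mxpowD -{1}(trmx_mxpow _ Ms).
apply: sumr_ge0 => i _; rewrite mxE; apply: sumr_ge0 => k _.
by rewrite mxE -expr2 sqr_ge0.
Qed.

(** Markov's inequality for the trace, nonnegative since the order is even. The successor in
    [(2 ^ j.+1).+1] is the strict inequality of the walk bound. *)
Lemma noise_tail (t j : nat) (omega sg a : R) : (0 < t < T)%N ->
  (forall s, (1 <= s <= T)%N -> norm1inf (mean s) <= omega) ->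
  0 < sg -> omega <= sg ^+ 2 -> 0 < a ->
  \sum_(z | a ^+ (2 ^ j.+1) < \tr (mxpow (noise_mx (link_noise t) z) (2 ^ j.+1)))
     prod_weight (link_mass Pi Theta) z
  <= n%:R * ((3 * sg + 4 * (2 ^ j.+1).+1%:R) / a) ^+ (2 ^ j.+1).
Proof.
move=> tT hom sg0 sgo a0; set m := (2 ^ j.+1)%N.
have am : 0 < a ^+ m by rewrite exprn_gt0.
rewrite exprMn exprVn mulrA ler_pdivlMr //.
apply: le_trans (prod_mean_trace_le (link_mean0 t) link_mass1
  (fun e k => link_moment_le e k tT) (@link_weight_loop t) sg0 (ltnSn m)
  (fun u => le_trans (link_weight_row u tT hom) sgo)
  (fun u v => link_weight_cell u v tT)).
rewrite /prod_mean mulr_suml big_mkcond; apply: ler_sum => z _.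
have w0 : 0 <= prod_weight (link_mass Pi Theta) z.
  by apply: prodr_ge0 => e _; exact: link_mass_ge0.
case: ifP => [h|_]; first by rewrite ler_wpM2l // ltW.
by rewrite mulr_ge0 // trace_even_ge0 // noise_mx_sym.
Qed.

End Noise.

Lemma noise_mxE (R : realType) (d : measure_display) (W : measurableType d)
    (P : probability W R) (n T : nat) (Pi : 'M[R]_n) (Theta : nat -> 'M[R]_n)
    (A Om : nat -> 'I_n -> 'I_n -> {RV P >-> bool}) (Y : nat -> W -> 'M[R]_n) t w :
  network_parameters T Pi Theta -> missing_links_data T Pi Theta A Om Y ->
  (0 < t < T)%N ->
  cusum T (Y^~ w) t - cusum T (fun s => hadamard Pi (Theta s)) t =
  noise_mx (link_noise Pi Theta t) (outcome_fun T A Om w).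
Proof.
move=> params data /andP[t0 tT].
rewrite !cusum_coefE ?(ltnW tT) // -sumrB big_add1 big_mkord /=.
apply/matrixP => u v; rewrite summxE mxE; apply: eq_bigr => s _.
rewrite -scalerBr mxE [X in _ * X = _]mxE [X in _ * (_ + X) = _]mxE ffunE.
have lt_case (x y : 'I_n) : (x < y)%N ->
    cusum_coef R T t s.+1 * (Y s.+1 w x y - hadamard Pi (Theta s.+1) x y) =
    link_noise Pi Theta t (s, [set x; y]%SET) (link_outcome A Om w (s, [set x; y]%SET)).
  move=> xy; rewrite /link_noise /link_outcome (@unedge_edge _ _ (s, x, y)) //=.
  by rewrite (obs_eq data _ (time_itv s) xy).
have [uv|vu|uv] := ltngtP u v; first exact: lt_case.
  by rewrite finset.setUC (mean_sym params) (obs_sym data _ (time_itv s)) lt_case.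
rewrite (val_inj uv) /link_noise unedge_loop (mean_diag params).
by rewrite (obs_diag data _ (time_itv s)) subrr mulr0.
Qed.

Lemma noise_union_tail (R : realType) (n T : nat) (Pi : 'M[R]_n) (Theta : nat -> 'M[R]_n)
    (j : nat) (omega sg a : R) :
  network_parameters T Pi Theta ->
  (forall s, (1 <= s <= T)%N -> norm1inf (hadamard Pi (Theta s)) <= omega) ->
  0 < sg -> omega <= sg ^+ 2 -> 0 < a ->
  \sum_(z | [exists t : 'I_T, (0 < t)%N && (a ^+ (2 ^ j.+1)
        < \tr (mxpow (noise_mx (link_noise Pi Theta t) z) (2 ^ j.+1)))])
     prod_weight (@link_mass R n T Pi Theta) z
  <= T%:R * (n%:R * ((3 * sg + 4 * (2 ^ j.+1).+1%:R) / a) ^+ (2 ^ j.+1)).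
Proof.
move=> params hom sg0 sgo a0.
pose bad (t : 'I_T) (z : {ffun 'I_T * {set 'I_n} -> bool * bool}) :=
  (0 < t)%N && (a ^+ (2 ^ j.+1) < \tr (mxpow (noise_mx (link_noise Pi Theta t) z) (2 ^ j.+1))).
have w0 z : 0 <= prod_weight (@link_mass R n T Pi Theta) z.
  by apply: prodr_ge0 => e _; exact: link_mass_ge0.
apply: (@le_trans _ _ (\sum_t \sum_(z | bad t z) prod_weight (@link_mass R n T Pi Theta) z)).
  under [leRHS]eq_bigr do rewrite big_mkcond.
  rewrite exchange_big big_mkcond /=; apply: ler_sum => z _.
  have s0 (t : 'I_T) : 0 <= if bad t z then prod_weight (link_mass Pi Theta) z else 0.
    by case: ifP.
  case: existsP => [[t bt]|_]; last by apply: sumr_ge0 => t _; exact: s0.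
  by rewrite (bigD1 t) //= [bad t z]bt lerDl sumr_ge0.
rewrite mulr_natl -[in leRHS](card_ord T) -sumr_const; apply: ler_sum => t _.
(* ['I_T] contains 0, at which the statistic is not considered: its bad set is empty. *)
have [t0|t0] := posnP t; last first.
  rewrite (eq_bigl (fun z => a ^+ (2 ^ j.+1) <
     \tr (mxpow (noise_mx (link_noise Pi Theta t) z) (2 ^ j.+1)))) => [|z]; last first.
    by rewrite /bad t0.
  have tT : (0 < t < T)%N by rewrite t0 ltn_ord.
  exact: (noise_tail params j tT hom sg0 sgo a0).
rewrite big_pred0 => [|z]; last by rewrite /bad t0.
by rewrite mulr_ge0 // exprn_ge0 // divr_ge0 ?addr_ge0 ?mulr_ge0 // ltW.
Qed.

(** * Choice of the moment order, constants and conclusion *)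

(** Takes the least power of two that is at least [N], the integer part of [4 * L] plus one. Half of
    it is below [N], so it is at most [8 * L]. *)
Lemma moment_order (R : realType) (L : R) : 1 <= L ->
  exists j, 4 * L <= (2 ^ j.+1)%:R <= 10 * L.
Proof.
move=> L1; pose N := (Num.truncn (4 * L)).+1.
have L0 : 0 <= 4 * L by lra.
have /andP[NL LN] : N.-1%:R <= 4 * L < N%:R by exact: truncn_itv.
have N2 : (1 < N)%N by rewrite ltnS truncn_gt0; lra.
have [] := andP (up_log_bounds (ltnSn 1) N2).
have : (0 < up_log 2 N)%N by rewrite up_log_gt0 N2.
case: (up_log 2 N) => // j _ /= jN Nj; exists j; apply/andP; split.
  by rewrite (le_trans (ltW LN)) // ler_nat.
have : (2 ^ j)%:R <= N.-1%:R :> R by rewrite ler_nat -ltnS.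
by rewrite expnS natrM => h; lra.
Qed.

(** The left side is [2^-1] to the power [2 ^ j], where [2 ^ j >= 2 * L], and
    [2^-1 <= expR (- 2^-1)]. This fixes the factor 4 in [moment_order]. *)
Lemma sqrt2_power_le_expR (R : realType) (L B : R) j : 0 < B -> 4 * L <= (2 ^ j.+1)%:R ->
  (B / (Num.sqrt 2 * B)) ^+ (2 ^ j.+1) <= expR (- L).
Proof.
move=> B0 hL; rewrite invfM mulrCA mulfV ?gt_eqF // mulr1 exprVn expnS exprM.
rewrite sqr_sqrtr // -exprVn.
have h : 2^-1 <= expR (- 2^-1) :> R by apply: le_trans (expR_ge1Dx _); lra.
apply: (@le_trans _ _ (expR (- 2^-1) ^+ (2 ^ j))).
  by rewrite lerXn2r ?nnegrE ?expR_ge0 // invr_ge0.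
rewrite -expRM_natl ler_expR; move: hL; rewrite expnS natrM; lra.
Qed.

(** The argument is at least 4, and [ln 2 >= 2^-1]. *)
Lemma ln_factor_ge1 (R : realType) (n T : nat) (gamma : R) : (0 < n)%N -> (2 <= T)%N ->
  0 < gamma < 1 -> 1 <= ln (2 * n%:R * T%:R / gamma).
Proof.
move=> n0 T2 /andP[g0 g1].
have n1 : 1 <= n%:R :> R by rewrite ler1n.
have T2R : 2 <= T%:R :> R by rewrite ler_nat.
have h : 2 ^+ 2 <= 2 * n%:R * T%:R / gamma.
  rewrite ler_pdivlMr //; nra.
have l2 : 2^-1 <= ln 2 :> R.
  have : 2^-1 <= expR (- 2^-1) :> R by apply: le_trans (expR_ge1Dx _); lra.
  rewrite expRN lef_pV2 ?posrE ?expR_gt0 // => e2.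
  by rewrite -ler_expR lnK ?posrE.
apply: (@le_trans _ _ (ln (2 ^+ 2))); first by rewrite lnXn // mulr2n; lra.
by rewrite ler_ln ?posrE // (lt_le_trans _ h).
Qed.

(** Beyond the leading [6 sqrt 2 sqrt omega], the right side of the hypothesis is at most
    [2 sqrt 2 (7 + 40 L)], hence at most [188 L] by [sqrt 2 <= 2] and [1 <= L]; this is below
    [200 L]. *)
Lemma deviation_rate (R : realType) (T omega L eps q Delta dist m : R) :
  0 < T -> 0 <= omega -> 1 <= L -> 0 <= eps -> 0 < q -> 0 < Delta -> m <= 10 * L + 1 ->
  Num.sqrt T * q * dist * Delta
    <= 2 * (Num.sqrt 2 * (3 * (Num.sqrt omega + 1) + 4 * m)) ->
  dist <= 6 * Num.sqrt 2 * (1 + eps) / (Delta * q) * Num.sqrt (omega / T)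
    + 200 / (Delta * q) * (L / Num.sqrt T).
Proof.
move=> T0 omega0 L1 eps0 q0 Delta0 mL; rewrite sqrtrM // sqrtrV ?(ltW T0) //.
have t0 : 0 < Num.sqrt T by rewrite sqrtr_gt0.
have s0 : 0 <= Num.sqrt 2 :> R by exact: sqrtr_ge0.
have s2 : Num.sqrt 2 <= 2 :> R.
  by rewrite -(ler_pXn2r (n := 2)) ?nnegrE // sqr_sqrtr // expr2; lra.
have o0 : 0 <= Num.sqrt omega by exact: sqrtr_ge0.
move: (Num.sqrt T) (Num.sqrt 2) (Num.sqrt omega) t0 s0 s2 o0 => t s o t0 s0 s2 o0 h.
have -> : 6 * s * (1 + eps) / (Delta * q) * (o / t) + 200 / (Delta * q) * (L / t)
  = (6 * s * (1 + eps) * o + 200 * L) / (t * q * Delta).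
  by field; rewrite !gt_eqF.
rewrite ler_pdivlMr ?mulr_gt0 // mulrC mulrAC; apply: le_trans h _.
have so : 0 <= s * o by rewrite mulr_ge0.
have soe : 0 <= s * o * eps by rewrite mulr_ge0.
have sm : s * m <= s * (10 * L + 1) by rewrite ler_wpM2l.
have sL : s * L <= 2 * L by rewrite ler_wpM2r //; lra.
have sL1 : s <= s * L by rewrite ler_peMr.
lra.
Qed.

Theorem proposition2 (R : realType) (eps : R) (heps : 0 < eps <= 2^-1) :
  exists C : R, 0 < C /\
  forall (d : measure_display) (W : measurableType d) (P : probability W R)
    (n T : nat) (gamma : R) (Pi : 'M[R]_n) (Theta : nat -> 'M[R]_n)
    (Y : nat -> W -> 'M[R]_n) (tau : nat) (dTheta : 'M[R]_n) (omega : R)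
    (tauhat : {RV P >-> nat}),
  (2 <= T)%N ->
  0 < gamma < 1 ->
  missing_links_network P T Pi Theta Y ->
  (1 <= tau < T)%N ->
  change_point T Theta tau dTheta ->
  dTheta != 0 ->
  (forall t, (1 <= t <= T)%N -> norm1inf (hadamard Pi (Theta t)) <= omega) ->
  (forall w, cusum_argmax T (fun t => Y t w) (tauhat w)) ->
  let Delta := opnorm22 (hadamard Pi dTheta) in
  let xstar := tau%:R / T%:R in
  ((1 - gamma)%:E <
   P [set w | (`| (tauhat w)%:R / T%:R - xstar | <=
       6 * Num.sqrt 2 * (1 + eps) / (Delta * qfun xstar)
         * Num.sqrt (omega / T%:R)
       + C / (Delta * qfun xstar)
         * (ln (2 * n%:R * T%:R / gamma) / Num.sqrt T%:R))%R])%E.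
Proof.
exists 200; split=> [|d W]; first by rewrite ltr0n.
move=> P n T gamma Pi Theta Y tau dTheta omega tauhat.
move=> T2 gamma01 [params [A [Om data]]] tauT [Th0 [Th1 Th2]] dT0 hom argmax.
set Delta := opnorm22 (hadamard Pi dTheta); set xs : R := tau%:R / T%:R.
cbv zeta.
have /andP[g0 g1] := gamma01; have /andP[eps0 _] := heps.
have /matrix0Pn[i [i' dTi]] := dT0.
have n0 : (0 < n)%N by exact: leq_ltn_trans (leq0n i) (ltn_ord i).
have Delta0 : 0 < Delta.
  apply: opnorm22_gt0; apply/matrix0Pn; exists i, i'.
  by rewrite mxE mulf_neq0 // gt_eqF // (Pi_gt0 params).
have T0 : 0 < T%:R :> R by rewrite ltr0n (leq_trans _ T2).
have xs01 : 0 < xs < 1.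
  have /andP[tau0 tauT'] := tauT.
  rewrite /xs ltr_pdivrMr // mul1r ltr_nat tauT' andbT.
  by rewrite divr_gt0 // ltr0n.
have q0 : 0 < qfun xs by rewrite sqrtr_gt0 mulr_gt0 ?subr_gt0; case/andP: xs01.
have omega0 : 0 <= omega.
  have T1 : (1 <= 1 <= T)%N by rewrite (leq_trans _ T2).
  exact: le_trans (bigmax_ge_id _ _ _ _) (hom 1 T1).
set L := ln _.
have L1 : 1 <= L by exact: ln_factor_ge1.
have [j /andP[jL Lj]] := moment_order L1.
(* Adding 1 keeps [sg] positive when [omega] vanishes; it only costs a constant, absorbed in the
   logarithmic term. *)
pose sg := Num.sqrt omega + 1; pose m := (2 ^ j.+1)%N.
have sqo0 : 0 <= Num.sqrt omega by exact: sqrtr_ge0.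
have sg0 : 0 < sg by rewrite ltr_wpDl.
have sgo : omega <= sg ^+ 2.
  rewrite -[leLHS]sqr_sqrtr // ler_pXn2r ?nnegrE ?(ltW sg0) //.
  by rewrite lerDl.
pose B := 3 * sg + 4 * m.+1%:R; pose a := Num.sqrt 2 * B.
have B0 : 0 < B by rewrite ltr_wpDr ?mulr_ge0 // mulr_gt0.
have s20 : 0 < Num.sqrt 2 :> R by rewrite sqrtr_gt0.
have a0 : 0 < a by rewrite mulr_gt0.
pose bad (z : {ffun 'I_T * {set 'I_n} -> bool * bool}) :=
  [exists t : 'I_T, (0 < t)%N && (a ^+ m
     < \tr (mxpow (noise_mx (link_noise Pi Theta t) z) m))].
have [mbad Pbad] := outcome_prob params data (predC bad).
(* Here [expR (- L)] equals [gamma / (2nT)], so the union bound gives [gamma / 2], which leaves room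
   for the strict inequality. *)
have mass_bad : \sum_(z | bad z) prod_weight (link_mass Pi Theta) z < gamma.
  apply: le_lt_trans (noise_union_tail j params hom sg0 sgo a0) _.
  apply: (@le_lt_trans _ _ (T%:R * (n%:R * expR (- L)))).
    by rewrite !ler_wpM2l // sqrt2_power_le_expR.
  rewrite expRN lnK ?posrE; last first.
    by rewrite divr_gt0 // !mulr_gt0 // ltr0n.
  have n0R : n%:R != 0 :> R by rewrite pnatr_eq0 -lt0n.
  have -> : T%:R * (n%:R * (2 * n%:R * T%:R / gamma)^-1) = gamma / 2.
    by move: n0R (gt_eqF T0) (gt_eqF g0); clear => n0R T0R gR; field; rewrite n0R T0R gR.
  by rewrite ltr_pdivrMr // ltr_pMr // ltr1n.
have mass_all : \sum_z prod_weight (@link_mass R n T Pi Theta) z = 1.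
  by apply: sum_prod_weight => e; exact: link_mass1.
have mass_good : 1 - gamma < \sum_(z | predC bad z) prod_weight (link_mass Pi Theta) z.
  by rewrite ltrBlDr -mass_all (bigID bad) /= addrC ltrD2l.
(* The event without bad noise is included in the claimed one: there every noise trace is at most
   [a ^+ m], so every noise norm is at most [a]. *)
apply: (@lt_le_trans _ _ (P [set w | predC bad (outcome_fun T A Om w)])).
  by rewrite Pbad lte_fin.
apply: le_measure; rewrite ?inE //.
  rewrite -[X in measurable X]setTI.
  pose S := [set k : nat | `|k%:R / T%:R - xs| <=
    6 * Num.sqrt 2 * (1 + eps) / (Delta * qfun xs) * Num.sqrt (omega / T%:R)
    + 200 / (Delta * qfun xs) * (L / Num.sqrt T%:R)].
  have mS : measurable S by [].
  have mtauhat : measurable_fun setT tauhat by exact: measurable_funP.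
  exact: (mtauhat measurableT S mS).
move=> w /= good.
have noise s : (0 < s < T)%N ->
    opnorm22 (cusum T (Y^~ w) s - cusum T (fun s => hadamard Pi (Theta s)) s) <= a.
  move=> sT; rewrite (noise_mxE _ params data) //.
  apply: (opnorm22_trace (j := j)); [exact: noise_mx_sym|exact: ltW|].
  rewrite leNgt; apply: contra good => h; apply/existsP.
  have /andP[s0 sT'] := sT.
  by exists (Ordinal sT'); rewrite /= s0.
apply: (@deviation_rate _ _ _ _ _ _ _ _ m.+1%:R) => //; first exact: ltW.
  by rewrite -natr1 lerD2r.
apply: (cusum_argmax_bound tauT _ _ noise (argmax w) (M0 := hadamard Pi Th0)).
  by move=> s /Th1 ->.
by move=> s /Th2 ->; apply/matrixP => u v; rewrite !mxE mulrDr.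
Qed.
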